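(* Fix any positive integers $p$ and $d$. There is an algorithm which, given a simple graph $H=([n],E)$ of tree-depth at most $d$, functions $f_1,\dots,f_n:\mathbb{Z}\rightarrow\mathbb{Z}$, a partition $E=\biguplus_{k=1}^pE_k$ of the edge set into $p$ parts, and integers $0\leq m_k\leq|E_k|$ for $k=1,\dots,p$, solves in polynomial time the colored degree sequence optimization problem $$\max\left\{\sum_{i=1}^n f_i(d_i(G))\ :\ G=([n],F)\subseteq H,\ \ |F\cap E_k|=m_k,\ \ k=1,\dots, p\right\}\ .$$
   Context: For a simple graph $H=(V,E)$ with $V=[n]:=\{1,\dots,n\}$, $d_i(H):=|\{e\in E: i\in e\}|$ is the degree of vertex $i$. Subgraphs $G=([n],F)\subseteq H$ have the full vertex set $[n]$ and edge set $F\subseteq E$. The functions $f_i$ need only be given on $\{0,1,\dots,d_i(H)\}$ (e.g. by their values there). Tree-depth: the height of a rooted tree is the maximum number of vertices on a path from the root to a leaf; a rooted tree on $V$ is valid for a graph $G=(V,E)$ if for each edge $\{i,j\}\in E$ one of $i,j$ lies on the path from the root to the other; the tree-depth of $G$ is the smallest height of a rooted tree on $V$ valid for $G$. *)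

(* Defs.v *)
From mathcomp Require Import all_boot all_order all_algebra.
Set Implicit Arguments. Unset Strict Implicit. Unset Printing Implicit Defensive.
Import Order.TTheory GRing.Theory Num.Theory.

(* Tape alphabet 'I_S.+3 : symbol 0 is the blank, symbols 1 and 2 encode    *)
(* the bits false/true, the remaining S symbols are working symbols.         *)
(* States 'I_Q.+1, start state 0; delta = None means "halt".                *)

Inductive move := MLeft | MRight | MStay.

Record TM := mkTM {
  tm_Q : nat;
  tm_S : nat;
  tm_delta : 'I_tm_Q.+1 -> 'I_tm_S.+3 ->
             option ('I_tm_Q.+1 * 'I_tm_S.+3 * move) }.

Section Machine.
Variable M : TM.
Local Notation state := 'I_(tm_Q M).+1.
Local Notation sym := 'I_(tm_S M).+3.

(* configuration: state, tape left of head (nearest first), head, right *)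
Record config := Config {
  c_state : state; c_left : seq sym; c_head : sym; c_right : seq sym }.

Definition blank : sym := inord 0.
Definition sym_of_bit (b : bool) : sym := inord (1 + b).

Definition step (c : config) : option config :=
  match @tm_delta M (c_state c) (c_head c) with
  | None => None
  | Some (q', b, mv) =>
    match mv with
    | MStay => Some (Config q' (c_left c) b (c_right c))
    | MRight =>
      match c_right c with
      | [::] => Some (Config q' (b :: c_left c) blank [::])
      | x :: r => Some (Config q' (b :: c_left c) x r)
      end
    | MLeft =>
      match c_left c with
      | [::] => Some (Config q' [::] blank (b :: c_right c))
      | x :: l => Some (Config q' l x (b :: c_right c))
      end
    end
  end.

Fixpoint exec (t : nat) (c : config) : option config :=
  match step c with
  | None => Some c
  | Some c' => match t with 0 => None | t'.+1 => exec t' c' end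
  end.

Definition init (w : seq bool) : config :=
  match map sym_of_bit w with
  | [::] => Config ord0 [::] blank [::]
  | x :: r => Config ord0 [::] x r
  end.

Fixpoint read_bits (s : seq sym) : seq bool :=
  match s with
  | [::] => [::]
  | x :: r => if val x == 1 then false :: read_bits r
              else if val x == 2 then true :: read_bits r else [::]
  end.

Definition output (c : config) : seq bool := read_bits (c_head c :: c_right c).

End Machine.

(* Tokens (2 bits): 00 = bit 0, 01 = bit 1, 10 = open, 11 = close.          *)

Fixpoint bits_aux (fuel n : nat) : seq bool :=
  match fuel with
  | 0 => [::]
  | f.+1 => if n == 0 then [::] else odd n :: bits_aux f n./2
  end.
Definition bits (n : nat) : seq bool := bits_aux n n.

Inductive data := DNat of nat | DList of seq data.

Fixpoint enc (x : data) : seq bool :=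
  match x with
  | DNat n => [:: true; false] ++ flatten (map (fun b => [:: false; b]) (bits n))
              ++ [:: true; true]
  | DList l => [:: true; false] ++ flatten (map enc l) ++ [:: true; true]
  end.

Definition DInt (z : int) : data :=
  match z with
  | Posz k => DList [:: DNat 0; DNat k]
  | Negz k => DList [:: DNat 1; DNat k.+1]
  end.

(* Vertices are 0..n-1 (standing for 1..n); edges are pairs (i,j), i<j<n;   *)
(* lab assigns to each edge its part (0..p-1, standing for 1..p);           *)
(* m = [m_1..m_p]; f = [f_1..f_n] with f_i given by its values on           *)
(* 0..d_i(H).                                                                *)

Record instance := Inst {
  i_n : nat;
  i_E : seq (nat * nat);
  i_lab : seq nat;
  i_m : seq nat;
  i_f : seq (seq int) }.

Definition enc_instance (I : instance) : seq bool :=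
  enc (DList [:: DNat (i_n I);
                 DList [seq DList [:: DNat e.1; DNat e.2] | e <- i_E I];
                 DList (map DNat (i_lab I));
                 DList (map DNat (i_m I));
                 DList [seq DList (map DInt fi) | fi <- i_f I]]).

Definition deg (E : seq (nat * nat)) (i : nat) : nat :=
  count (fun e => (e.1 == i) || (e.2 == i)) E.

(* Rooted trees on {0..n-1}, given by a parent function (None at the root). *)
Definition anc (par : nat -> option nat) (u v : nat) : Prop :=
  exists k, iter k (obind par) (Some v) = Some u.

Definition rooted_tree (n : nat) (par : nat -> option nat) : Prop :=
  exists2 r, r < n &
    par r = None /\
    (forall v u, v < n -> par v = Some u -> u < n) /\
    (forall v, v < n -> anc par r v).

(* height <= d : every root-to-vertex path has at most d vertices *)
Definition height_le (n : nat) (par : nat -> option nat) (d : nat) : Prop :=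
  forall v, v < n -> iter d (obind par) (Some v) = None.

Definition valid_tree (E : seq (nat * nat)) (par : nat -> option nat) : Prop :=
  forall e, e \in E -> anc par e.1 e.2 \/ anc par e.2 e.1.

Definition treedepth_le (n : nat) (E : seq (nat * nat)) (d : nat) : Prop :=
  exists par, [/\ rooted_tree n par, valid_tree E par & height_le n par d].

Definition valid_instance (p d : nat) (I : instance) : Prop :=
  [/\ all (fun e => (e.1 < e.2) && (e.2 < i_n I)) (i_E I) /\ uniq (i_E I),
      size (i_lab I) = size (i_E I) /\ all (fun k => k < p) (i_lab I),
      size (i_m I) = p /\
        (forall k, k < p -> nth 0 (i_m I) k <= count (pred1 k) (i_lab I)),
      size (i_f I) = i_n I /\
        (forall i, i < i_n I -> size (nth [::] (i_f I) i) = (deg (i_E I) i).+1)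
    & treedepth_le (i_n I) (i_E I) d].

(* A subgraph G = ([n], F) of H is given by a selection mask over E. *)
Definition feasible (p : nat) (I : instance) (sel : seq bool) : Prop :=
  size sel = size (i_E I) /\
  forall k, k < p -> count (pred1 k) (mask sel (i_lab I)) = nth 0 (i_m I) k.

Definition objective (I : instance) (sel : seq bool) : int :=
  (\sum_(i < i_n I) nth 0 (nth [::] (i_f I) i) (deg (mask sel (i_E I)) i))%R.

Definition enc_answer (a : option (seq bool)) : seq bool :=
  match a with
  | None => enc (DList [:: DNat 0])
  | Some sel => enc (DList [:: DNat 1; DList (map (fun b : bool => DNat b) sel)])
  end.

Definition solves (p : nat) (I : instance) (out : seq bool) : Prop :=
  (exists sel, [/\ out = enc_answer (Some sel), feasible p I sel &
                   forall sel', feasible p I sel' ->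
                     (objective I sel' <= objective I sel)%R])
  \/ (out = enc_answer None /\ ~ exists sel, feasible p I sel).

(* Main.v *)
Require Import Defs.
From mathcomp Require Import all_boot all_order all_algebra.
From mathcomp Require Import zify.
Set Implicit Arguments. Unset Strict Implicit. Unset Printing Implicit Defensive.

(** The graph [H] is searched depth first.  The visited vertices that still have
    an unvisited neighbour always lie on one path of [H], and a graph of
    tree-depth at most [d] has no path with [2^d] vertices.  Process the edges in
    the order in which their second endpoint is visited, maintaining a list of
    partial selections: two selections are interchangeable for the edges to come
    when they agree on the number of edges of each colour and on the degrees of
    the at most [2^d] vertices that meet both a processed and an unprocessed edge.
    Keeping one best selection per class leaves at most [(|E|+1)^(2^d+p)] of them.

    Polynomial time on a Turing machine is obtained from a class [ptime] of
    functions on typed data, closed under the usual list-programming constructs: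
    data are binary trees in prefix code on a bit stack, and a one-tape machine
    simulates four such stacks on parallel tracks. *)

(** * Four stacks on one tape *)

(** The tree witnessing the tree-depth is not part of the input and is never computed: it serves
    only to bound the paths of the graph, hence the number of classes and the running time.
    Arbitrary functions [f_i] leave no room for greedy choices, but the objective is a sum over
    vertices: adding an edge changes the objective of two selections equally when they agree on the
    degrees of its endpoints. A vertex without remaining edges has a final contribution, and one
    without processed edges has degree 0, so only boundary vertices matter.

    The obstacle to a polynomial bound is iteration, since a polynomial-time step may square its
    data each time. Closure of [ptime] under folds therefore demands a bound on every intermediate
    accumulator. For the dynamic program this bound is the number of classes, available only under
    the tree-depth promise, so complexity is stated over the type of valid instances. *)

Inductive reg := RA | RB | RC | RN.

Record store := Store { sA : seq bool; sB : seq bool; sC : seq bool; sN : seq bool }.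

Definition get r s := match r with RA => sA s | RB => sB s | RC => sC s | RN => sN s end.

Definition set r l s :=
  let: Store a b c n := s in
  match r with
  | RA => Store l b c n | RB => Store a l c n
  | RC => Store a b l n | RN => Store a b c l
  end.

Definition ssize s := size (sA s) + size (sB s) + size (sC s) + size (sN s).

Inductive instr :=
  | IJmp of nat
  | IPush of reg & bool & nat
  | IPop of reg & nat & nat & nat.

(* Stacks are lists, top first; the bottom of each stack sits in cell 0 of its
   track, and a cell stores its four tracks as base-3 digits, track A being the
   lowest, so that a tape holding only A is a tape of blanks and bit symbols. *)
Definition dig (l : seq bool) j : nat :=
  if j < size l then (nth false (rev l) j).+1 else 0.

Definition cell s j :=
  dig (sA s) j + 3 * dig (sB s) j + 9 * dig (sC s) j + 27 * dig (sN s) j.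

(** [81 = 3^4] is the first number that is not the code of four base-3 digits. The marker is written
    immediately to the left of cell 0 and tells the head where the stacks begin. *)
Definition marker := 81.

Definition weight r := match r with RA => 1 | RB => 3 | RC => 9 | RN => 27 end.
Definition track r x := (x %/ weight r) %% 3.
Definition put r v x := x - track r x * weight r + v * weight r.

Lemma dig_lt3 l j : dig l j < 3.
Proof. by rewrite /dig; case: ifP => // _; case: nth. Qed.

Lemma dig_eq0 l j : (dig l j == 0) = (size l <= j).
Proof. by rewrite /dig [RHS]leqNgt; case: (j < _). Qed.

Lemma dig_cons b l j :
  dig (b :: l) j = if j == size l then b.+1 else dig l j.
Proof.
rewrite /dig /= rev_cons nth_rcons size_rev ltnS.
by case: ltngtP => //=.
Qed.

Lemma cell_lt s j : cell s j < marker.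
Proof.
rewrite /cell /marker.
have := (dig_lt3 (sA s) j, dig_lt3 (sB s) j, dig_lt3 (sC s) j, dig_lt3 (sN s) j).
by case=> [[[? ?] ?] ?]; lia.
Qed.

Lemma track_cell r s j : track r (cell s j) = dig (get r s) j.
Proof.
rewrite /cell /track.
have := (dig_lt3 (sA s) j, dig_lt3 (sB s) j, dig_lt3 (sC s) j, dig_lt3 (sN s) j).
by case: r => /= -[[[? ?] ?] ?]; lia.
Qed.

Lemma cell_set r l s j : cell (set r l s) j = put r (dig l j) (cell s j).
Proof.
rewrite /put track_cell; case: s => a b c n; rewrite /cell.
by case: r => /=; lia.
Qed.

Lemma put_track r x : put r (track r x) x = x.
Proof.
rewrite /put subnK //.
apply: leq_trans (leq_divM x (weight r)); rewrite leq_mul2r /track leq_mod orbT //.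
Qed.

Lemma ssize_get r s : size (get r s) <= ssize s.
Proof. by case: s r => ? ? ? ? []; rewrite /ssize /=; lia. Qed.

Lemma ssize_set r l s : ssize (set r l s) + size (get r s) = ssize s + size l.
Proof. by case: s r => ? ? ? ? []; rewrite /ssize /=; lia. Qed.

(** States 0 and 1 write the marker; each program position then gets three states. For a stack
    operation, [q_go] moves right to the first cell that is empty on the track, [q_take] stands one
    cell before it (the top of the stack, or the marker if the stack is empty), and [q_back] returns
    to cell 0, its index being the position to continue at. *)
Definition q_go pc := 2 + 3 * pc.
Definition q_back pc := 3 + 3 * pc.
Definition q_take pc := 4 + 3 * pc.

Section Machine.
Variable P : seq instr.

(* All jump targets are clamped to [size P], the halting position. *)
Definition clamp pc := minn pc (size P).

Definition trans (q x : nat) : option (nat * nat * move) :=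
  if q == 0 then Some (1, x, MLeft) else
  if q == 1 then Some (q_go 0, marker, MRight) else
  let pc := (q - 2) %/ 3 in
  match (q - 2) %% 3 with
  | 0 =>
    match onth P pc with
    | None => None
    | Some (IJmp n) => Some (q_go (clamp n), x, MStay)
    | Some (IPush r b n) =>
      if track r x == 0 then Some (q_back (clamp n), put r b.+1 x, MStay)
      else Some (q, x, MRight)
    | Some (IPop r _ _ _) =>
      if track r x == 0 then Some (q_take pc, x, MLeft) else Some (q, x, MRight)
    end
  | 1 => if x == marker then Some (q_go pc, x, MRight) else Some (q, x, MLeft)
  | _ =>
    match onth P pc with
    | Some (IPop r ne n0 n1) =>
      if x == marker then Some (q_go (clamp ne), x, MRight) else
      Some (q_back (clamp (if track r x == 2 then n1 else n0)), put r 0 x, MStay)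
    | _ => None
    end
  end.

(** [79.+3 = 82] symbols are the cell codes 0 to 80 and the marker; the largest state,
    [4 + 3 * size P], is [q_take (size P)]. *)
Definition machine : TM :=
  @mkTM (4 + 3 * size P) 79
    (fun q x => if trans q x is Some (q', y, mv) then Some (inord q', inord y, mv)
                else None).

Notation cfg := (config machine).
Notation sym x := (inord x : 'I_(tm_S machine).+3).
Notation st x := (inord x : 'I_(tm_Q machine).+1).

Definition runs n (c c' : cfg) := forall t, exec (n + t) c = exec t c'.

Lemma runs_trans m n c1 c2 c3 : runs m c1 c2 -> runs n c2 c3 -> runs (m + n) c1 c3.
Proof. by move=> h1 h2 t; rewrite -addnA h1 h2. Qed.

Lemma runs1 c c' : step c = Some c' -> runs 1 c c'.
Proof. by move=> h t; rewrite add1n /= h. Qed.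

(** The head is on cell [k]. The left list starts next to the head, hence the reversal and the
    marker at its end. The right list is constrained only pointwise with default blank, because
    empty cells beyond it have code 0, the blank. *)
Definition rep q s k (c : cfg) :=
  [/\ c_state c = st q,
      c_left c = rcons (rev (mkseq (fun j => sym (cell s j)) k)) (sym marker),
      c_head c = sym (cell s k)
    & forall i, nth (blank machine) (c_right c) i = sym (cell s (k.+1 + i))].

Definition rep_marker q s (c : cfg) :=
  [/\ c_state c = st q, c_left c = [::], c_head c = sym marker
    & forall i, nth (blank machine) (c_right c) i = sym (cell s i)].

Lemma step_trans (c : cfg) q x q' y mv :
  c_state c = st q -> c_head c = sym x -> q <= 4 + 3 * size P -> x <= marker ->
  trans q x = Some (q', y, mv) ->
  step c = match mv with
    | MStay => Some (Config (st q') (c_left c) (sym y) (c_right c))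
    | MRight => Some (Config (st q') (sym y :: c_left c)
                 (nth (blank machine) (c_right c) 0) (behead (c_right c)))
    | MLeft => Some (Config (st q') (behead (c_left c))
                 (nth (blank machine) (c_left c) 0) (sym y :: c_right c))
    end.
Proof.
case: c => cs cl ch cr /= -> -> hq hx ht; rewrite /step /=.
rewrite !inordK ?ht //; case: mv {ht} => //.
- by case: cl.
- by case: cr.
Qed.

Lemma rep_right q q' s k c :
  rep q s k c -> q <= 4 + 3 * size P ->
  trans q (cell s k) = Some (q', cell s k, MRight) ->
  exists2 c', step c = Some c' & rep q' s k.+1 c'.
Proof.
case=> h1 h2 h3 h4 hq ht.
rewrite (step_trans h1 h3 hq (ltnW (cell_lt s k)) ht); eexists; first by [].
split=> //=.
- by rewrite h2 mkseqS rev_rcons.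
- by rewrite h4 addn0.
- by move=> i; rewrite nth_behead h4 addnS addSn.
Qed.

Lemma rep_left q q' s k c :
  rep q s k.+1 c -> q <= 4 + 3 * size P ->
  trans q (cell s k.+1) = Some (q', cell s k.+1, MLeft) ->
  exists2 c', step c = Some c' & rep q' s k c'.
Proof.
case=> h1 h2 h3 h4 hq ht.
rewrite (step_trans h1 h3 hq (ltnW (cell_lt s _)) ht); eexists; first by [].
split=> //=.
- by rewrite h2 mkseqS rev_rcons.
- by rewrite h2 mkseqS rev_rcons.
- by case=> [|i] /=; rewrite ?addn0 ?h4 ?addnS // addSn.
Qed.

Lemma rep_left0 q q' s c :
  rep q s 0 c -> q <= 4 + 3 * size P ->
  trans q (cell s 0) = Some (q', cell s 0, MLeft) ->
  exists2 c', step c = Some c' & rep_marker q' s c'.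
Proof.
case=> h1 h2 h3 h4 hq ht.
rewrite (step_trans h1 h3 hq (ltnW (cell_lt s _)) ht); eexists; first by [].
by split=> //=; rewrite ?h2 // => -[|i] //=; rewrite h4.
Qed.

Lemma rep_marker_right q q' s c :
  rep_marker q s c -> q <= 4 + 3 * size P ->
  trans q marker = Some (q', marker, MRight) ->
  exists2 c', step c = Some c' & rep q' s 0 c'.
Proof.
case=> h1 h2 h3 h4 hq ht.
rewrite (step_trans h1 h3 hq (leqnn _) ht); eexists; first by [].
by split=> //=; rewrite ?h2 // => i; rewrite nth_behead h4.
Qed.

Lemma rep_stay q q' s s' k c :
  rep q s k c -> q <= 4 + 3 * size P ->
  (forall j, j != k -> cell s' j = cell s j) ->
  trans q (cell s k) = Some (q', cell s' k, MStay) ->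
  exists2 c', step c = Some c' & rep q' s' k c'.
Proof.
case=> h1 h2 h3 h4 hq hs ht.
rewrite (step_trans h1 h3 hq (ltnW (cell_lt s _)) ht); eexists; first by [].
split=> //=.
- rewrite h2; congr (rcons (rev _) _); apply/eq_in_map => j.
  by rewrite mem_iota add0n => /andP[_ hj]; rewrite hs // ltn_eqF.
- by move=> i; rewrite h4 hs // gtn_eqF // addSn ltnS leq_addr.
Qed.

Lemma clamp_le pc : clamp pc <= size P. Proof. exact: geq_minr. Qed.

Lemma clampE pc i : onth P pc = Some i -> clamp pc = pc /\ pc < size P.
Proof.
move=> h; suff hp : pc < size P by split=> //; apply/minn_idPl/ltnW.
by rewrite ltnNge -onthNE h.
Qed.

Lemma q_goK pc : (q_go pc - 2) %/ 3 = pc /\ (q_go pc - 2) %% 3 = 0.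
Proof. by rewrite /q_go; lia. Qed.
Lemma q_backK pc : (q_back pc - 2) %/ 3 = pc /\ (q_back pc - 2) %% 3 = 1.
Proof. by rewrite /q_back; lia. Qed.
Lemma q_takeK pc : (q_take pc - 2) %/ 3 = pc /\ (q_take pc - 2) %% 3 = 2.
Proof. by rewrite /q_take; lia. Qed.

Lemma runs_back pc s k c :
  pc <= size P -> rep (q_back pc) s k c ->
  exists2 c', runs k.+2 c c' & rep (q_go pc) s 0 c'.
Proof.
move=> hpc; have hq : q_back pc <= 4 + 3 * size P by rewrite /q_back; lia.
have [e1 e2] := q_backK pc.
elim: k c => [|k IH] c hc.
  have [|c1 s1 r1] := rep_left0 (q' := q_back pc) hc hq.
    by rewrite /trans e1 e2 (ltn_eqF (cell_lt _ _)).
  have [|c2 s2 r2] := rep_marker_right (q' := q_go pc) r1 hq.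
    by rewrite /trans e1 e2 eqxx.
  by exists c2 => //; apply: (runs_trans (m := 1) (runs1 s1)); apply: runs1.
have [|c1 s1 r1] := rep_left (q' := q_back pc) hc hq.
  by rewrite /trans e1 e2 (ltn_eqF (cell_lt _ _)).
have [c2 s2 r2] := IH _ r1.
by exists c2 => //; apply: (runs_trans (m := 1) (runs1 s1)).
Qed.

Lemma runs_go r pc s c :
  pc < size P ->
  (forall x, track r x != 0 -> trans (q_go pc) x = Some (q_go pc, x, MRight)) ->
  rep (q_go pc) s 0 c ->
  exists2 c', runs (size (get r s)) c c' & rep (q_go pc) s (size (get r s)) c'.
Proof.
move=> hpc hr hc; have hq : q_go pc <= 4 + 3 * size P by rewrite /q_go; lia.
suff : forall k, k <= size (get r s) ->
  exists2 c', runs k c c' & rep (q_go pc) s k c' by apply.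
elim=> [|k IH] hk; first by exists c.
have [c1 s1 r1] := IH (ltnW hk).
have [|c2 s2 r2] := rep_right (q' := q_go pc) r1 hq.
  by apply: hr; rewrite track_cell dig_eq0 -ltnNge.
by exists c2 => //; rewrite -addn1; apply: runs_trans s1 (runs1 s2).
Qed.

Definition reach t pc s pc' s' :=
  forall c, rep (q_go (clamp pc)) s 0 c ->
  exists n c', [/\ n <= t, runs n c c' & rep (q_go (clamp pc')) s' 0 c'].

Lemma reach_trans t1 t2 t pc1 s1 pc2 s2 pc3 s3 :
  reach t1 pc1 s1 pc2 s2 -> reach t2 pc2 s2 pc3 s3 -> t1 + t2 <= t ->
  reach t pc1 s1 pc3 s3.
Proof.
move=> h1 h2 ht c /h1[n1 [c1 [l1 r1 /h2[n2 [c2 [l2 r2 ?]]]]]].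
exists (n1 + n2), c2; split=> //; last exact: runs_trans r1 r2.
by apply: leq_trans ht; apply: leq_add.
Qed.

Lemma reach_jmp pc n s : onth P pc = Some (IJmp n) -> reach 1 pc s n s.
Proof.
move=> h c; have [-> hpc] := clampE h => hc.
have hq : q_go pc <= 4 + 3 * size P by rewrite /q_go; lia.
have [e1 e2] := q_goK pc.
have [||c1 s1 r1] := rep_stay (s' := s) (q' := q_go (clamp n)) hc hq => //.
  by rewrite /trans e1 e2 h.
by exists 1, c1; split=> //; apply: runs1.
Qed.

Lemma cell_push r b s j :
  j != size (get r s) -> cell (set r (b :: get r s) s) j = cell s j.
Proof.
by move=> hj; rewrite cell_set dig_cons (negPf hj) -track_cell put_track.
Qed.

Lemma reach_push pc r b n s :
  onth P pc = Some (IPush r b n) ->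
  reach (2 * size (get r s) + 3) pc s n (set r (b :: get r s) s).
Proof.
move=> h c; have [-> hpc] := clampE h => hc.
have hq : q_go pc <= 4 + 3 * size P by rewrite /q_go; lia.
have [e1 e2] := q_goK pc.
have [|c1 s1 r1] := runs_go (r := r) hpc _ hc.
  by move=> x hx; rewrite /trans e1 e2 h (negPf hx).
have [||c2 s2 r2] := rep_stay (s' := set r (b :: get r s) s)
  (q' := q_back (clamp n)) r1 hq.
- by move=> j /cell_push.
- rewrite /trans e1 e2 h track_cell dig_eq0 leqnn; congr (Some (_, _, _)).
  by rewrite cell_set dig_cons eqxx.
have [c3 s3 r3] := runs_back (clamp_le n) r2.
exists (size (get r s) + 1 + (size (get r s)).+2), c3; split=> //; first lia.
exact: runs_trans (runs_trans s1 (runs1 s2)) s3.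
Qed.

Lemma reach_pop_empty pc r ne n0 n1 s :
  onth P pc = Some (IPop r ne n0 n1) -> get r s = [::] -> reach 2 pc s ne s.
Proof.
move=> h hs c; have [-> hpc] := clampE h => hc.
have hq : q_go pc <= 4 + 3 * size P by rewrite /q_go; lia.
have hq' : q_take pc <= 4 + 3 * size P by rewrite /q_take; lia.
have [e1 e2] := q_goK pc; have [e3 e4] := q_takeK pc.
have [|c1 s1 r1] := rep_left0 (q' := q_take pc) hc hq.
  by rewrite /trans e1 e2 h track_cell dig_eq0 hs.
have [|c2 s2 r2] := rep_marker_right (q' := q_go (clamp ne)) r1 hq'.
  by rewrite /trans e3 e4 h eqxx.
by exists 2, c2; split=> //; apply: (runs_trans (m := 1) (runs1 s1)); apply: runs1.
Qed.

Lemma reach_pop pc r ne n0 n1 s b l :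
  onth P pc = Some (IPop r ne n0 n1) -> get r s = b :: l ->
  reach (2 * size (get r s) + 3) pc s (if b then n1 else n0) (set r l s).
Proof.
move=> h hs c; have [-> hpc] := clampE h => hc.
have hq : q_go pc <= 4 + 3 * size P by rewrite /q_go; lia.
have hq' : q_take pc <= 4 + 3 * size P by rewrite /q_take; lia.
have [e1 e2] := q_goK pc; have [e3 e4] := q_takeK pc.
have [|c1 s1 r1] := runs_go (r := r) hpc _ hc.
  by move=> x hx; rewrite /trans e1 e2 h (negPf hx).
rewrite hs /= in s1 r1 *.
have [|c2 s2 r2] := rep_left (q' := q_take pc) r1 hq.
  by rewrite /trans e1 e2 h track_cell dig_eq0 hs leqnn.
have [||c3 s3 r3] := rep_stay (s' := set r l s)
  (q' := q_back (clamp (if b then n1 else n0))) r2 hq'.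
- move=> j hj; rewrite cell_set -[RHS](put_track r) track_cell hs.
  by rewrite dig_cons (negPf hj).
- rewrite /trans e3 e4 h track_cell hs dig_cons eqxx (ltn_eqF (cell_lt _ _)).
  rewrite cell_set; have /eqP -> : dig l (size l) == 0 by rewrite dig_eq0.
  by case: (b).
have [c4 s4 r4] := runs_back (clamp_le _) r3.
exists ((size l).+1 + (1 + (1 + (size l).+2))), c4; split=> //; first lia.
exact: runs_trans s1 (runs_trans (runs1 s2) (runs_trans (runs1 s3) s4)).
Qed.

Lemma exec_halt n (c c' : cfg) s :
  runs n c c' -> rep (q_go (size P)) s 0 c' -> exec n c = Some c'.
Proof.
move=> h [h1 _ h3 _]; rewrite -(addn0 n) h /= /step h1 h3 /=.
have [e1 e2] := q_goK (size P).
rewrite inordK; last by rewrite /q_go; lia.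
by rewrite /trans e1 e2 onth_default.
Qed.

Lemma dig_rev (w : seq bool) j :
  dig (rev w) j = if j < size w then (nth false w j).+1 else 0.
Proof. by rewrite /dig size_rev revK. Qed.

Lemma runs_init w :
  exists2 c', runs 2 (init machine w) c'
    & rep (q_go (clamp 0)) (Store (rev w) [::] [::] [::]) 0 c'.
Proof.
pose s := Store (rev w) [::] [::] [::].
have -> : clamp 0 = 0 by apply: min0n.
have hcell j : cell s j = dig (rev w) j by rewrite /cell /dig /=; lia.
have hw j : nth (blank machine) (map (@sym_of_bit machine) w) j = sym (cell s j).
  rewrite hcell dig_rev; case: ltnP => hj.
    by rewrite (nth_map false) //.
  by rewrite nth_default ?size_map.
pose c0 := init machine w.
have [x [r [hc hx]]] : exists x r, c0 = Config ord0 [::] x r /\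
    forall j, nth (blank machine) (x :: r) j = sym (cell s j).
  rewrite /c0 /init; case E : (map _ w) hw => [|x r] hw.
    by exists (blank machine), [::]; split=> // -[|j] //=; rewrite -hw ?nth_nil.
  by exists x, r.
have hx0 : x = sym (cell s 0) by rewrite -hx.
have st0 : c_state c0 = st 0 by rewrite hc; apply/val_inj; rewrite /= inordK.
have s1 := @step_trans c0 0 (cell s 0) 1 (cell s 0) MLeft st0.
rewrite hc /= in s1; have {s1} s1 := s1 hx0 isT (ltnW (cell_lt _ _)) erefl.
pose c1 : cfg := Config (st 1) [::] (blank machine) (sym (cell s 0) :: r).
have s2 := @step_trans c1 1 0 (q_go 0) marker MRight erefl erefl isT isT erefl.
rewrite -/c0 hc; eexists.
  by apply: (runs_trans (m := 1) (runs1 s1)); apply: runs1 s2.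
by split=> //= i; have := hx i.+1.
Qed.

Lemma read_bits_cells (l : seq 'I_(tm_S machine).+3) w :
  (forall i, nth (blank machine) l i = sym (dig (rev w) i)) -> read_bits l = w.
Proof.
elim: w l => [|b w IH] l hl.
  case: l hl => // x l /(_ 0) /=; rewrite dig_rev /= => ->.
  by rewrite /= inordK.
case: l hl => [|x l] hl.
  by have /(congr1 val) := hl 0; rewrite /= dig_rev /= /blank !inordK //; case: (b).
have hl0 := hl 0; rewrite /= dig_rev /= in hl0.
rewrite /= hl0 inordK; last by case: (b).
rewrite (IH l); first by case: (b).
by move=> i; have := hl i.+1; rewrite !dig_rev.
Qed.

Lemma output_rep pc o c :
  rep (q_go pc) (Store o [::] [::] [::]) 0 c -> output c = rev o.
Proof.
case=> _ _ h3 h4; rewrite /output; apply: read_bits_cells => i.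
have hcell j : cell (Store o [::] [::] [::]) j = dig o j.
  by rewrite /cell /dig /=; lia.
by rewrite revK; case: i => [|i] /=; rewrite ?h3 ?h4 hcell.
Qed.

End Machine.

(* The last argument of [run] is an upper bound on the number of stack operations.
   [Loop r ce c0 c1 l0 l1] pops stack [r] and runs the branch selected by the
   result; the flag of a bit tells whether the loop is then entered again. *)
Inductive cmd :=
  | Skip
  | Push of reg & bool
  | Seq of cmd & cmd
  | Loop of reg & cmd & cmd & cmd & bool & bool.

Inductive run : cmd -> store -> store -> nat -> Prop :=
  | run_skip s t : run Skip s s t.+1
  | run_push r b s t : run (Push r b) s (set r (b :: get r s) s) t.+1
  | run_seq c1 c2 s1 s2 s3 t1 t2 :
      run c1 s1 s2 t1 -> run c2 s2 s3 t2 -> run (Seq c1 c2) s1 s3 (t1 + t2)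
  | run_empty r ce c0 c1 l0 l1 s s' t :
      get r s = [::] -> run ce s s' t -> run (Loop r ce c0 c1 l0 l1) s s' t.+1
  | run_exit r ce c0 c1 l0 l1 b l s s' t :
      get r s = b :: l -> (if b then l1 else l0) = false ->
      run (if b then c1 else c0) (set r l s) s' t ->
      run (Loop r ce c0 c1 l0 l1) s s' t.+1
  | run_loop r ce c0 c1 l0 l1 b l s s1 s2 t1 t2 :
      get r s = b :: l -> (if b then l1 else l0) = true ->
      run (if b then c1 else c0) (set r l s) s1 t1 ->
      run (Loop r ce c0 c1 l0 l1) s1 s2 t2 ->
      run (Loop r ce c0 c1 l0 l1) s s2 (t1 + t2).+1.

Lemma run_ssize c s s' t : run c s s' t -> ssize s' <= ssize s + t.
Proof.
elim=> {c s s' t} /=.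
- by move=> *; rewrite leq_addr.
- by move=> r b s t; have := ssize_set r (b :: get r s) s; rewrite /=; lia.
- by move=> *; lia.
- by move=> *; lia.
- by move=> r _ _ _ _ _ b l s s' t h _ _ ?; have := ssize_set r l s; rewrite h /=; lia.
- by move=> r _ _ _ _ _ b l s s' ? ? ? h _ _ ? _ ?; have := ssize_set r l s; rewrite h /=; lia.
Qed.

Lemma run_weak c s s' t t' : run c s s' t -> t <= t' -> run c s s' t'.
Proof.
move=> h; elim: h t' => {c s s' t} /=.
- by move=> s t [|t'] // _; apply: run_skip.
- by move=> r b s t [|t'] // _; apply: run_push.
- move=> c1 c2 s1 s2 s3 t1 t2 r1 _ _ IH t' ht'.
  have -> : t' = t1 + (t' - t1) by lia.
  by apply: run_seq r1 (IH _ _); lia.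
- by move=> r ce c0 c1 l0 l1 s s' t hs _ IH [|t'] // ht'; apply: run_empty (IH _ _).
- by move=> r ce c0 c1 l0 l1 b l s s' t hs hl _ IH [|t'] // ht'; apply: run_exit hs hl (IH _ _).
- move=> r ce c0 c1 l0 l1 b l s s1 s2 t1 t2 hs hl r1 _ _ IH [|t'] // ht'.
  have -> : t' = t1 + (t' - t1) by lia.
  by apply: run_loop hs hl r1 (IH _ _); lia.
Qed.

(** * Compilation of structured programs into jumps *)

Fixpoint len c :=
  match c with
  | Seq c1 c2 => len c1 + len c2
  | Loop _ ce c0 c1 _ _ => (len ce + (len c0 + len c1)).+1
  | _ => 1
  end.

Fixpoint compile c base exit : seq instr :=
  match c with
  | Skip => [:: IJmp exit]
  | Push r b => [:: IPush r b exit]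
  | Seq c1 c2 => compile c1 base (base + len c1) ++ compile c2 (base + len c1) exit
  | Loop r ce c0 c1 l0 l1 =>
      let b0 := base.+1 + len ce in
      let b1 := b0 + len c0 in
      IPop r base.+1 b0 b1
      :: compile ce base.+1 exit
         ++ compile c0 b0 (if l0 then base else exit)
         ++ compile c1 b1 (if l1 then base else exit)
  end.

Lemma size_compile c base exit : size (compile c base exit) = len c.
Proof.
elim: c base exit => [|r b|c1 h1 c2 h2|r c1 h1 c2 h2 c3 h3 l0 l1] base exit //=;
  by rewrite !size_cat ?h1 ?h2 ?h3.
Qed.

Definition embedded (P : seq instr) base cs :=
  forall i, i < size cs -> onth P (base + i) = onth cs i.

Lemma embedded_catl P base s1 s2 : embedded P base (s1 ++ s2) -> embedded P base s1.
Proof.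
move=> h i hi; rewrite h ?size_cat; last by rewrite ltn_addr.
by rewrite onth_cat hi.
Qed.

Lemma embedded_catr P base s1 s2 :
  embedded P base (s1 ++ s2) -> embedded P (base + size s1) s2.
Proof.
move=> h i hi; rewrite -addnA h ?size_cat ?ltn_add2l //.
by rewrite onth_cat ltnNge leq_addr /= addKn.
Qed.

(** A run of cost [t] pushes at most [t] bits, so no stack ever holds more than [ssize s + t]. One
    instruction scans one stack out and back, which takes at most [W] machine steps, and [t] bounds
    the number of instructions. *)
Lemma compile_reach P c s s' t : run c s s' t ->
  forall W base exit, 2 * (ssize s + t) + 4 <= W ->
  embedded P base (compile c base exit) -> reach P (t * W) base s exit s'.
Proof.
have weak t1 t2 pc1 s1 pc2 s2 : t1 <= t2 -> reach P t1 pc1 s1 pc2 s2 ->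
    reach P t2 pc1 s1 pc2 s2.
  move=> hle h c0 /h[n [c1 [l1 r1 ?]]]; exists n, c1; split=> //.
  exact: leq_trans hle.
have first base x l : embedded P base (x :: l) -> onth P base = Some x.
  by move=> /(_ 0 isT); rewrite addn0.
have rest base x l : embedded P base (x :: l) -> embedded P base.+1 l.
  by move=> h i hi; have := h i.+1 hi; rewrite addnS addSn.
elim=> {c s s' t} /=.
- move=> s t W base exit hW /first /reach_jmp h; apply: weak (h s); lia.
- move=> r b s t W base exit hW /first /reach_push h; apply: weak (h s).
  by have := ssize_get r s; lia.
- move=> c1 c2 s1 s2 s3 t1 t2 r1 IH1 r2 IH2 W base exit hW he.
  have hs := run_ssize r1.
  have he1 := embedded_catl he; have := embedded_catr he.
  rewrite size_compile => he2; rewrite mulnDl.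
  by apply: reach_trans (IH1 _ _ _ _ he1) (IH2 _ _ _ _ he2) (leqnn _); lia.
- move=> r ce c0 c1 l0 l1 s s' t hs r1 IH W base exit hW he.
  have h := reach_pop_empty (first _ _ _ he) hs.
  have he1 := embedded_catl (rest _ _ _ he).
  by apply: reach_trans h (IH W _ _ _ he1) _; lia.
- move=> r ce c0 c1 l0 l1 b l s s' t hs hl r1 IH W base exit hW he.
  have h := reach_pop (first _ _ _ he) hs; rewrite hs /= in h.
  have hz := ssize_set r l s; have hz' := ssize_get r s; rewrite hs /= in hz hz'.
  have := embedded_catr (rest _ _ _ he); rewrite size_compile => he1.
  have := embedded_catr he1; rewrite size_compile => he2.
  have {}he1 := embedded_catl he1.
  by case: (b) h hl IH r1 => /= h hl IH r1; rewrite ?hl in he1 he2;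
    apply: reach_trans h (IH W _ _ _ _) _; first [eassumption | lia].
- move=> r ce c0 c1 l0 l1 b l s s1 s2 t1 t2 hs hl r1 IH1 r2 IH2 W base exit hW he.
  have h := reach_pop (first _ _ _ he) hs; rewrite hs /= in h.
  have hz := ssize_set r l s; have hz' := ssize_get r s; rewrite hs /= in hz hz'.
  have := embedded_catr (rest _ _ _ he); rewrite size_compile => he1.
  have := embedded_catr he1; rewrite size_compile => he2.
  have {}he1 := embedded_catl he1.
  have h2 : reach P (t2 * W) base s1 exit s2.
    by apply: IH2 he; have := run_ssize r1; lia.
  suff h1 : reach P (W + t1 * W) base s base s1.
    by apply: reach_trans h1 h2 _; lia.
  by case: (b) h hl IH1 r1 => /= h hl IH1 r1; rewrite ?hl in he1 he2;
    apply: reach_trans h (IH1 W _ _ _ _) _; first [eassumption | lia].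
Qed.

Lemma simulate c w o t : run c (Store (rev w) [::] [::] [::]) (Store o [::] [::] [::]) t ->
  let M := machine (compile c 0 (len c)) in
  exists t' (cf : config M),
    [/\ t' <= 2 + t * (2 * (size w + t) + 4), exec t' (init M w) = Some cf
      & output cf = rev o].
Proof.
move=> h M; have hP := size_compile c 0 (len c).
have [c1 r1 p1] := runs_init (compile c 0 (len c)) w.
have := compile_reach (P := compile c 0 (len c)) (base := 0) (exit := len c) h (leqnn _) _.
rewrite [ssize _]/ssize /= size_rev !addn0 => /(_ (fun i _ => erefl) c1 p1)[n [c2 [hn r2 p2]]].
exists (2 + n), c2; split; first by rewrite leq_add2l.
  apply: (exec_halt (s := Store o [::] [::] [::])) (runs_trans r1 r2) _.
  by move: p2; rewrite /clamp !hP minnn.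
exact: output_rep p2.
Qed.

(** * Stack programs on binary trees *)

Inductive tree := Leaf | Node of tree & tree.

Fixpoint pcode x := if x is Node a b then true :: pcode a ++ pcode b else [:: false].
Fixpoint sz x := if x is Node a b then (sz a + sz b).+1 else 1.

Lemma size_pcode x : size (pcode x) = sz x.
Proof. by elim: x => //= a ha b hb; rewrite size_cat ha hb. Qed.

Lemma sz_gt0 x : 0 < sz x. Proof. by case: x. Qed.

Notation onA l := (Store l [::] [::] [::]).

Definition ifpop r c0 c1 := Loop r Skip c0 c1 false false.
Definition while_pop r c0 c1 := Loop r Skip c0 c1 true true.

Lemma run_ifpop r c0 c1 s s' b l t : get r s = b :: l ->
  run (if b then c1 else c0) (set r l s) s' t -> run (ifpop r c0 c1) s s' t.+1.
Proof. by move=> h; apply: run_exit h _; case: b. Qed.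

Lemma run_while_pop r c0 c1 s s1 s2 b l t1 t2 : get r s = b :: l ->
  run (if b then c1 else c0) (set r l s) s1 t1 -> run (while_pop r c0 c1) s1 s2 t2 ->
  run (while_pop r c0 c1) s s2 (t1 + t2).+1.
Proof. by move=> h; apply: run_loop h _; case: b. Qed.

Lemma run_ifA c0 c1 b A B C N s' t :
  run (if b then c1 else c0) (Store A B C N) s' t ->
  run (ifpop RA c0 c1) (Store (b :: A) B C N) s' t.+1.
Proof. exact: (@run_ifpop RA c0 c1 (Store (b :: A) B C N) s' b A). Qed.

Lemma run_whileB c0 c1 b A B C N s1 s2 t1 t2 :
  run (if b then c1 else c0) (Store A B C N) s1 t1 -> run (while_pop RB c0 c1) s1 s2 t2 ->
  run (while_pop RB c0 c1) (Store A (b :: B) C N) s2 (t1 + t2).+1.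
Proof. exact: (@run_while_pop RB c0 c1 (Store A (b :: B) C N) s1 s2 b B). Qed.

Lemma run_whileN c0 c1 b A B C N s1 s2 t1 t2 :
  run (if b then c1 else c0) (Store A B C N) s1 t1 -> run (while_pop RN c0 c1) s1 s2 t2 ->
  run (while_pop RN c0 c1) (Store A B C (b :: N)) s2 (t1 + t2).+1.
Proof. exact: (@run_while_pop RN c0 c1 (Store A B C (b :: N)) s1 s2 b N). Qed.

Lemma run_while_end r c0 c1 s : get r s = [::] -> run (while_pop r c0 c1) s s 2.
Proof. by move=> h; apply: run_empty h _; apply: run_skip. Qed.

Lemma run_push1 r b s s' : s' = set r (b :: get r s) s -> run (Push r b) s s' 1.
Proof. by move=> ->; apply: run_push. Qed.

Definition pour r1 r2 := while_pop r1 (Push r2 false) (Push r2 true).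

Lemma run_pour r1 r2 s : r1 <> r2 ->
  run (pour r1 r2) s (set r1 [::] (set r2 (catrev (get r1 s) (get r2 s)) s))
    (2 * size (get r1 s) + 2).
Proof.
move=> ne; move E: (get r1 s) => l; elim: l s E => [|b l IH] s h.
  have -> : set r1 [::] (set r2 (catrev [::] (get r2 s)) s) = s.
    by case: s h => ? ? ? ?; case: r1 ne; case: r2 => //= _ ->.
  exact: run_while_end.
pose s1 := set r2 (b :: get r2 (set r1 l s)) (set r1 l s).
have h1 : get r1 s1 = l by rewrite /s1; case: s {IH h s1} => ? ? ? ?; case: r1 ne; case: r2.
have := IH s1 h1.
have -> : set r1 [::] (set r2 (catrev l (get r2 s1)) s1) =
          set r1 [::] (set r2 (catrev (b :: l) (get r2 s)) s).
  by rewrite /s1; case: s {IH h s1 h1} => ? ? ? ?; case: r1 ne; case: r2.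
move=> r; apply: run_weak.
  by apply: run_while_pop h _ r; rewrite /s1; case: (b); apply: run_push1.
by rewrite /=; lia.
Qed.

Lemma run_pourBA a b c n :
  run (pour RB RA) (Store a b c n) (Store (catrev b a) [::] c n) (2 * size b + 2).
Proof. exact: (@run_pour RB RA (Store a b c n)). Qed.

Lemma run_pourCA a b c n :
  run (pour RC RA) (Store a b c n) (Store (catrev c a) b [::] n) (2 * size c + 2).
Proof. exact: (@run_pour RC RA (Store a b c n)). Qed.

Lemma run_pourBC a b c n :
  run (pour RB RC) (Store a b c n) (Store a [::] (catrev b c) n) (2 * size b + 2).
Proof. exact: (@run_pour RB RC (Store a b c n)). Qed.

Lemma run_pourCB a b c n :
  run (pour RC RB) (Store a b c n) (Store a (catrev c b) [::] n) (2 * size c + 2).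
Proof. exact: (@run_pour RC RB (Store a b c n)). Qed.

Lemma run_pourAB a b c n :
  run (pour RA RB) (Store a b c n) (Store [::] (catrev a b) c n) (2 * size a + 2).
Proof. exact: (@run_pour RA RB (Store a b c n)). Qed.

(* Extracting the topmost tree of [A]: stack [N] holds in unary the number of
   subtrees that remain to be read. *)
Definition extract_loop r :=
  while_pop RN
    (ifpop RA (Push r false) (Seq (Push r true) (Seq (Push RN true) (Push RN true))))
    (ifpop RA (Push r false) (Seq (Push r true) (Seq (Push RN true) (Push RN true)))).

Definition extract r := Seq (Push RN true) (extract_loop r).

(** The statement is in continuation form: it prefixes the reading of [x] to whatever the loop does
    afterwards with [k] trees pending. A node consumes one pending tree and creates two, so the
    induction hypotheses of both subtrees apply one after the other. *)
Lemma run_extract_loop_B x S b c k s' t :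
  run (extract_loop RB) (Store S (catrev (pcode x) b) c (nseq k true)) s' t ->
  run (extract_loop RB) (Store (pcode x ++ S) b c (nseq k.+1 true)) s' (t + 5 * sz x).
Proof.
elim: x S b k t => [|x IHx y IHy] S b k t h /=.
  apply: (@run_weak _ _ _ (2 + t).+1); last lia.
  by apply: run_whileN h => /=; apply: run_ifA; apply: run_push1.
apply: (@run_weak _ _ _ (4 + (t + 5 * sz y + 5 * sz x)).+1); last lia.
apply: run_whileN => /=.
  apply: run_ifA => /=.
  apply: (run_seq (t1 := 1)); first exact: run_push1.
  by apply: (run_seq (t1 := 1)); apply: run_push1.
by rewrite -catA; apply: (IHx _ _ k.+1); apply: IHy; move: h; rewrite /= !catrevE rev_cat -!catA.
Qed.

Lemma run_extract_loop_C x S b c k s' t :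
  run (extract_loop RC) (Store S b (catrev (pcode x) c) (nseq k true)) s' t ->
  run (extract_loop RC) (Store (pcode x ++ S) b c (nseq k.+1 true)) s' (t + 5 * sz x).
Proof.
elim: x S c k t => [|x IHx y IHy] S c k t h /=.
  apply: (@run_weak _ _ _ (2 + t).+1); last lia.
  by apply: run_whileN h => /=; apply: run_ifA; apply: run_push1.
apply: (@run_weak _ _ _ (4 + (t + 5 * sz y + 5 * sz x)).+1); last lia.
apply: run_whileN => /=.
  apply: run_ifA => /=.
  apply: (run_seq (t1 := 1)); first exact: run_push1.
  by apply: (run_seq (t1 := 1)); apply: run_push1.
by rewrite -catA; apply: (IHx _ _ k.+1); apply: IHy; move: h; rewrite /= !catrevE rev_cat -!catA.
Qed.

Lemma run_extract_B x S b c :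
  run (extract RB) (Store (pcode x ++ S) b c [::]) (Store S (catrev (pcode x) b) c [::])
    (5 * sz x + 3).
Proof.
apply: (@run_weak _ _ _ (1 + (2 + 5 * sz x))); last lia.
apply: run_seq; first exact: run_push1.
by apply: (@run_extract_loop_B _ _ _ _ 0); apply: run_while_end.
Qed.

Lemma run_extract_C x S b c :
  run (extract RC) (Store (pcode x ++ S) b c [::]) (Store S b (catrev (pcode x) c) [::])
    (5 * sz x + 3).
Proof.
apply: (@run_weak _ _ _ (1 + (2 + 5 * sz x))); last lia.
apply: run_seq; first exact: run_push1.
by apply: (@run_extract_loop_C _ _ _ _ 0); apply: run_while_end.
Qed.

Lemma run_seqW c1 c2 s1 s2 s3 t1 t2 t :
  run c1 s1 s2 t1 -> run c2 s2 s3 t2 -> t1 + t2 <= t -> run (Seq c1 c2) s1 s3 t.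
Proof. by move=> h1 h2; apply: run_weak (run_seq h1 h2). Qed.

Definition drop_tree := Seq (extract RB) (while_pop RB Skip Skip).

Lemma run_drop_tree x S :
  run drop_tree (onA (pcode x ++ S)) (onA S) (7 * sz x + 5).
Proof.
apply: run_seqW (run_extract_B _ _ _ _) _ _; last first.
  instantiate (1 := 2 * size (catrev (pcode x) [::]) + 2).
  by rewrite catrevE cats0 size_rev size_pcode; lia.
elim: (catrev _ _) => [|b l IH]; first exact: run_while_end.
apply: (@run_weak _ _ _ (1 + (2 * size l + 2)).+1); last by rewrite /=; lia.
by apply: run_whileB _ IH; case: (b); apply: run_skip.
Qed.

Definition dup_tree :=
  Seq (extract RB)
  (Seq (while_pop RB (Seq (Push RA false) (Push RC false))
                     (Seq (Push RA true) (Push RC true)))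
  (Seq (pour RC RB) (pour RB RA))).

Lemma run_dup_tree x S :
  run dup_tree (onA (pcode x ++ S)) (onA (pcode x ++ pcode x ++ S)) (12 * sz x + 9).
Proof.
have h2 l a c : run (while_pop RB (Seq (Push RA false) (Push RC false))
                     (Seq (Push RA true) (Push RC true)))
    (Store a l c [::]) (Store (catrev l a) [::] (catrev l c) [::]) (3 * size l + 2).
  elim: l a c => [|b l IH] a c; first exact: run_while_end.
  apply: (@run_weak _ _ _ (2 + (3 * size l + 2)).+1); last by rewrite /=; lia.
  apply: run_whileB _ (IH _ _).
  by case: (b); apply: (run_seq (t1 := 1)); apply: run_push1.
apply: run_seqW (run_extract_B _ _ _ _) _ _; last first.
  instantiate (1 := 7 * sz x + 6); lia.
apply: run_seqW (h2 _ _ _) _ _; last first.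
  instantiate (1 := 4 * sz x + 4); rewrite catrevE cats0 size_rev size_pcode; lia.
apply: run_seqW (run_pourCB _ _ _ _) _ _; last first.
  by instantiate (1 := 2 * sz x + 2); rewrite !catrevE !cats0 !size_rev size_pcode; lia.
have := run_pourBA (catrev (catrev (pcode x) [::]) S)
  (catrev (catrev (catrev (pcode x) [::]) [::]) [::]) [::] [::].
by rewrite !catrevE !cats0 !revK size_rev size_pcode.
Qed.

Definition swap_tree := Seq (extract RB) (Seq (extract RC) (Seq (pour RB RA) (pour RC RA))).

Lemma run_swap_tree x y S :
  run swap_tree (onA (pcode x ++ pcode y ++ S)) (onA (pcode y ++ pcode x ++ S))
    (7 * (sz x + sz y) + 10).
Proof.
apply: run_seqW (run_extract_B _ _ _ _) _ _; last first.
  by instantiate (1 := 2 * sz x + 7 * sz y + 7); lia.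
apply: run_seqW (run_extract_C _ _ _ _) _ _; last first.
  by instantiate (1 := 2 * sz x + 2 * sz y + 4); lia.
apply: run_seqW (run_pourBA _ _ _ _) _ _; last first.
  by instantiate (1 := 2 * sz y + 2); rewrite catrevE cats0 size_rev size_pcode; lia.
have := run_pourCA (catrev (catrev (pcode x) [::]) S) [::] (catrev (pcode y) [::]) [::].
by rewrite !catrevE !cats0 !revK size_rev size_pcode.
Qed.

(** * Polynomial-time functions *)

(** The base [n.+2] is at least 2 for every [n], so constants, sums and products are absorbed by the
    exponent and no coefficient has to be carried along. *)
Definition polyb (f : nat -> nat) := exists k, forall n, f n <= n.+2 ^ k.

Lemma polyb_le f g : polyb g -> (forall n, f n <= g n) -> polyb f.
Proof. by case=> k hk h; exists k => n; apply: leq_trans (hk n). Qed.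

Lemma polyb_pow k : polyb (fun n => n.+2 ^ k). Proof. by exists k. Qed.

Lemma polyb_id : polyb (fun n => n).
Proof. by exists 1 => n; rewrite expn1; lia. Qed.

Lemma polyb_const c : polyb (fun=> c).
Proof.
exists c => n; case: c => // c.
by apply: leq_trans (ltnW (ltn_expl _ (isT : 1 < 2))) _; rewrite leq_exp2r.
Qed.

Lemma polyb_add f g : polyb f -> polyb g -> polyb (fun n => f n + g n).
Proof.
case=> j hj [k hk]; exists (maxn j k).+1 => n.
apply: leq_trans (leq_add (hj n) (hk n)) _.
have hm i : i <= maxn j k -> n.+2 ^ i <= n.+2 ^ maxn j k by apply: leq_pexp2l.
apply: leq_trans (leq_add (hm _ (leq_maxl j k)) (hm _ (leq_maxr j k))) _.
by rewrite addnn -mul2n expnS leq_mul2r orbT.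
Qed.

Lemma polyb_mul f g : polyb f -> polyb g -> polyb (fun n => f n * g n).
Proof.
case=> j hj [k hk]; exists (j + k) => n.
by rewrite expnD leq_mul.
Qed.

Lemma polyb_S f : polyb f -> polyb (fun n => (f n).+1).
Proof.
by move=> hf; apply: polyb_le (polyb_add hf (polyb_const 1)) _ => n; rewrite addn1.
Qed.

Lemma polyb_comp f g : polyb f -> polyb g -> polyb (fun n => f (g n)).
Proof.
(* [g n + 2] is at most [n.+2 ^ k + 2], hence at most [n.+2 ^ k.+2]. *)
case=> j hj [k hk]; exists (k.+2 * j) => n.
apply: leq_trans (hj _) _; rewrite expnM; case: j {hj} => // j.
rewrite leq_exp2r //; have := hk n; have : 0 < n.+2 ^ k by rewrite expn_gt0.
rewrite !expnS; move: (n.+2 ^ k) => a; nia.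
Qed.

Lemma polyb_exp f k : polyb f -> polyb (fun n => (f n).+2 ^ k).
Proof. exact: (polyb_comp (polyb_pow k)). Qed.

Ltac solve_poly :=
  cbv beta; first [exact (polyb_const _) |
  lazymatch goal with
  | |- polyb (fun n => n) => exact polyb_id
  | |- polyb S => exact (polyb_S polyb_id)
  | |- polyb (fun n => n.+2 ^ ?k) => exact (polyb_pow k)
  | |- polyb (fun n => (@?f n).+2 ^ ?k) => apply (@polyb_exp f k); solve_poly
  | |- polyb (fun n => (@?f n) + (@?g n)) => apply (@polyb_add f g); solve_poly
  | |- polyb (fun n => (@?f n) * (@?g n)) => apply (@polyb_mul f g); solve_poly
  | |- polyb (fun n => (@?f n).+1) => apply (@polyb_S f); solve_poly
  | |- polyb (fun n => ?f (@?g n)) => apply (@polyb_comp f g); [assumption | solve_poly]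
  | |- _ => assumption
  end].

(** The quantifier over [S] lets a program work on the top tree of A while other data wait below;
    the three other stacks are empty before and after, so programs can be chained freely. *)
Definition does c x y t := forall S, run c (onA (pcode x ++ S)) (onA (pcode y ++ S)) t.

Lemma does_weak c x y t t' : does c x y t -> t <= t' -> does c x y t'.
Proof. by move=> h ht S; apply: run_weak (h S) ht. Qed.

Lemma does_size c x y t : does c x y t -> sz y <= sz x + t.
Proof.
move=> /(_ [::]) /run_ssize.
by rewrite /ssize /= !cats0 !size_pcode; lia.
Qed.

Lemma does_seq c1 c2 x y z t1 t2 :
  does c1 x y t1 -> does c2 y z t2 -> does (Seq c1 c2) x z (t1 + t2).
Proof. by move=> h1 h2 S; apply: run_seq (h1 S) (h2 S). Qed.

Fixpoint pushes l := if l is b :: l' then Seq (pushes l') (Push RA b) else Skip.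

Lemma run_pushes l S B C N :
  run (pushes l) (Store S B C N) (Store (l ++ S) B C N) (size l).+1.
Proof.
elim: l => [|b l IH] /=; first exact: run_skip.
by rewrite -addn1; apply: run_seq IH _; apply: run_push1.
Qed.

Definition const_tree y := Seq drop_tree (pushes (pcode y)).

Lemma does_const x y : does (const_tree y) x y (7 * sz x + sz y + 6).
Proof.
move=> S; apply: run_seqW (run_drop_tree _ _) (run_pushes _ _ _ _ _) _.
by rewrite size_pcode; lia.
Qed.

Definition pair_tree c1 c2 :=
  Seq dup_tree (Seq c1 (Seq swap_tree (Seq c2 (Seq swap_tree (Push RA true))))).

Lemma does_pair c1 c2 x y z t1 t2 :
  does c1 x y t1 -> does c2 x z t2 ->
  does (pair_tree c1 c2) x (Node y z) (40 * sz x + 20 * t1 + 20 * t2 + 40).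
Proof.
move=> h1 h2 S; have s1 := does_size h1; have s2 := does_size h2.
apply: (@run_weak _ _ _ ((12 * sz x + 9) + (t1 + ((7 * (sz y + sz x) + 10) +
  (t2 + ((7 * (sz z + sz y) + 10) + 1)))))); last lia.
apply: run_seq (run_dup_tree _ _) _; apply: run_seq (h1 _) _.
apply: run_seq (run_swap_tree _ _ _) _; apply: run_seq (h2 _) _.
apply: run_seq (run_swap_tree _ _ _) _; apply: run_push1.
by rewrite /= catA.
Qed.

Definition fst_tree := ifpop RA (Push RA false) (Seq swap_tree drop_tree).

Lemma does_fst x y : does fst_tree (Node x y) x (14 * (sz x + sz y) + 20).
Proof.
move=> S /=; apply: (@run_weak _ _ _ (7 * (sz x + sz y) + 10 + (7 * sz y + 5)).+1); last lia.
apply: run_ifA; rewrite -catA; apply: run_seq (run_swap_tree _ _ _) (run_drop_tree _ _).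
Qed.

Definition snd_tree := ifpop RA (Push RA false) drop_tree.

Lemma does_snd x y : does snd_tree (Node x y) y (7 * sz x + 6).
Proof.
move=> S /=; apply: (@run_weak _ _ _ (7 * sz x + 5).+1); last lia.
by apply: run_ifA; rewrite -catA; apply: run_drop_tree.
Qed.

Definition pop1 := ifpop RA Skip Skip.

Lemma run_pop1 b l B C N : run pop1 (Store (b :: l) B C N) (Store l B C N) 2.
Proof. by apply: run_ifA; case: b; apply: run_skip. Qed.

Definition pop3 := Seq pop1 (Seq pop1 pop1).

Lemma run_pop3 b1 b2 b3 l B C N :
  run pop3 (Store [:: b1, b2, b3 & l] B C N) (Store l B C N) 6.
Proof.
have h := run_pop1.
exact: run_seqW (h _ _ _ _ _) (run_seq (h _ _ _ _ _) (h _ _ _ _ _)) _.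
Qed.

(** * Codes of typed data and closure properties of polynomial time *)

Class coded (T : Type) := code : T -> tree.

(* Both truth values get codes of size 5, so that the size of the code of a bit
   sequence depends on its length only. *)
#[global] Instance coded_bool : coded bool :=
  fun b => if b then Node (Node Leaf Leaf) Leaf else Node Leaf (Node Leaf Leaf).
#[global] Instance coded_unit : coded unit := fun=> Leaf.
#[global] Instance coded_tree : coded tree := id.
#[global] Instance coded_prod X Y {cX : coded X} {cY : coded Y} : coded (X * Y) :=
  fun p => Node (code p.1) (code p.2).
#[global] Instance coded_seq X {cX : coded X} : coded (seq X) :=
  fix cs l := if l is a :: l' then Node (code a) (cs l') else Leaf.
#[global] Instance coded_nat : coded nat := fun n => code (bits n).

Notation csz x := (sz (code x)).

Lemma csz_pair X Y {cX : coded X} {cY : coded Y} (x : X) (y : Y) :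
  csz (x, y) = (csz x + csz y).+1.
Proof. by []. Qed.

Lemma csz_cons X {cX : coded X} (x : X) l : csz (x :: l) = (csz x + csz l).+1.
Proof. by []. Qed.

Lemma pcode_cons X {cX : coded X} (x : X) l S :
  pcode (code (x :: l)) ++ S = true :: pcode (code x) ++ pcode (code l) ++ S.
Proof. by rewrite /= -catA. Qed.

Lemma pcode_pair X Y {cX : coded X} {cY : coded Y} (x : X) (y : Y) S :
  pcode (code (x, y)) ++ S = true :: pcode (code x) ++ pcode (code y) ++ S.
Proof. by rewrite /= -catA. Qed.

(** The domain may be any type with a code, in particular a type of inputs satisfying a promise: the
    time bound is then required only for such inputs. *)
Definition ptime X Y {cX : coded X} {cY : coded Y} (f : X -> Y) :=
  exists c k, forall x, does c (code x) (code (f x)) ((csz x).+2 ^ k).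

Lemma ptimeI X Y (cX : coded X) (cY : coded Y) (f : X -> Y) c q :
  polyb q -> (forall x, does c (code x) (code (f x)) (q (csz x))) -> ptime f.
Proof. by case=> k hk h; exists c, k => x; apply: does_weak (h x) (hk _). Qed.

Lemma ptime_ext X Y (cX : coded X) (cY : coded Y) (f g : X -> Y) :
  f =1 g -> ptime f -> ptime g.
Proof. by move=> e [c [k h]]; exists c, k => x; rewrite -e. Qed.

Lemma ptime_size X Y (cX : coded X) (cY : coded Y) (f : X -> Y) :
  ptime f -> exists2 q, polyb q & forall x, csz (f x) <= q (csz x).
Proof.
case=> c [k h]; exists (fun n => n + n.+2 ^ k); first by solve_poly.
by move=> x; apply: does_size (h x).
Qed.

Lemma pt_id X (cX : coded X) : ptime (fun x : X => x).
Proof.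
apply: (@ptimeI _ _ _ _ _ Skip (fun=> 1)); first by solve_poly.
by move=> x S; apply: run_skip.
Qed.

Lemma pt_const X Y (cX : coded X) (cY : coded Y) (y : Y) : ptime (fun _ : X => y).
Proof.
apply: (@ptimeI _ _ _ _ _ _ (fun n => 7 * n + csz y + 6)); first by solve_poly.
by move=> x; apply: does_const.
Qed.

Lemma pt_comp X Y Z (cX : coded X) (cY : coded Y) (cZ : coded Z) (f : Y -> Z) (g : X -> Y) :
  ptime f -> ptime g -> ptime (fun x => f (g x)).
Proof.
move=> [c1 [j h1]] [c2 [k h2]].
apply: (@ptimeI _ _ _ _ _ (Seq c2 c1) (fun n => n.+2 ^ k + (n + n.+2 ^ k).+2 ^ j)).
  by solve_poly.
move=> x; apply: does_seq (h2 x) (does_weak (h1 _) _).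
by case: j {h1} => // j; rewrite leq_exp2r //; apply: does_size (h2 x).
Qed.

Lemma pt_pair X Y Z (cX : coded X) (cY : coded Y) (cZ : coded Z) (f : X -> Y) (g : X -> Z) :
  ptime f -> ptime g -> ptime (fun x => (f x, g x)).
Proof.
move=> [c1 [j h1]] [c2 [k h2]].
apply: (@ptimeI _ _ _ _ _ (pair_tree c1 c2)
  (fun n => 40 * n + 20 * n.+2 ^ j + 20 * n.+2 ^ k + 40)); first by solve_poly.
by move=> x; apply: does_pair.
Qed.

Lemma pt_fst X Y Z (cX : coded X) (cY : coded Y) (cZ : coded Z) (f : X -> Y * Z) :
  ptime f -> ptime (fun x => (f x).1).
Proof.
apply: (pt_comp (f := fun p : Y * Z => p.1)).
apply: (@ptimeI _ _ _ _ _ fst_tree (fun n => 14 * n + 20)); first by solve_poly.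
by case=> y z; apply: does_weak (does_fst _ _) _; rewrite csz_pair /=; lia.
Qed.

Lemma pt_snd X Y Z (cX : coded X) (cY : coded Y) (cZ : coded Z) (f : X -> Y * Z) :
  ptime f -> ptime (fun x => (f x).2).
Proof.
apply: (pt_comp (f := fun p : Y * Z => p.2)).
apply: (@ptimeI _ _ _ _ _ snd_tree (fun n => 7 * n + 6)); first by solve_poly.
by case=> y z; apply: does_weak (does_snd _ _) _; rewrite csz_pair /=; lia.
Qed.

Lemma pt_node X (cX : coded X) (f g : X -> tree) :
  ptime f -> ptime g -> ptime (fun x => Node (f x) (g x)).
Proof. exact: (@pt_pair X tree tree). Qed.

Definition left_child x := if x is Node a _ then a else Leaf.

Lemma pt_left_child X (cX : coded X) (f : X -> tree) :
  ptime f -> ptime (fun x => left_child (f x)).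
Proof.
apply: (pt_comp (f := left_child)).
apply: (@ptimeI _ _ _ _ _ fst_tree (fun n => 14 * n + 20)); first by solve_poly.
case=> [|a b]; last by apply: does_weak (does_fst _ _) _; rewrite /=; lia.
by move=> S; apply: run_ifA; apply: run_weak (run_push1 _) _.
Qed.

Lemma pt_if X Y (cX : coded X) (cY : coded Y) (b : X -> bool) (f g : X -> Y) :
  ptime b -> ptime f -> ptime g -> ptime (fun x => if b x then f x else g x).
Proof.
move=> [cb [i hb]] [c1 [j h1]] [c2 [k h2]].
(* The code of a truth value [b] is [true], [b] and three further symbols: [pop1] removes the first,
   the test consumes [b], and [pop3] discards the rest. *)
pose c := Seq dup_tree (Seq cb (Seq pop1 (ifpop RA (Seq pop3 c2) (Seq pop3 c1)))).
apply: (@ptimeI _ _ _ _ _ c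
  (fun n => (12 * n + 9) + (n.+2 ^ i + (2 + (6 + (n.+2 ^ j + n.+2 ^ k)).+1)))).
  by solve_poly.
move=> x S; apply: run_seq (run_dup_tree _ _) _; apply: run_seq (hb _ _) _.
case: (b x); apply: run_seq (run_pop1 _ _ _ _ _) _; apply: run_ifA.
  by apply: run_seqW (run_pop3 _ _ _ _ _ _ _) (h1 _ _) _; rewrite leq_add2l leq_addr.
by apply: run_seqW (run_pop3 _ _ _ _ _ _ _) (h2 _ _) _; rewrite leq_add2l leq_addl.
Qed.

Lemma pt_cons X Y (cX : coded X) (cY : coded Y) (f : X -> Y) (g : X -> seq Y) :
  ptime f -> ptime g -> ptime (fun x => f x :: g x).
Proof.
move=> [c1 [j h1]] [c2 [k h2]].
apply: (@ptimeI _ _ _ _ _ (pair_tree c1 c2)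
  (fun n => 40 * n + 20 * n.+2 ^ j + 20 * n.+2 ^ k + 40)); first by solve_poly.
by move=> x; apply: does_pair.
Qed.

Lemma pt_nilp X Y (cX : coded X) (cY : coded Y) (f : X -> seq Y) :
  ptime f -> ptime (fun x => nilp (f x)).
Proof.
apply: (pt_comp (f := (@nilp Y))).
pose c := ifpop RA (pushes (pcode (coded_bool true)))
  (Seq drop_tree (Seq drop_tree (pushes (pcode (coded_bool false))))).
apply: (@ptimeI _ _ _ _ _ c (fun n => (7 * n + 30).+1)); first by solve_poly.
case=> [|a l] S; rewrite ?pcode_cons; apply: run_ifA.
  by apply: run_weak (run_pushes _ _ _ _ _) _.
rewrite csz_cons.
apply: (@run_weak _ _ _ ((7 * csz a + 5) + ((7 * csz l + 5) + 6))); last lia.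
apply: run_seq (run_drop_tree _ _) _; apply: run_seq (run_drop_tree _ _) _.
exact: run_pushes.
Qed.

Lemma pt_head X Y (cX : coded X) (cY : coded Y) y0 (f : X -> seq Y) :
  ptime f -> ptime (fun x => head y0 (f x)).
Proof.
apply: (pt_comp (f := (head y0))).
pose c := ifpop RA (pushes (pcode (@code Y cY y0))) (Seq swap_tree drop_tree).
apply: (@ptimeI _ _ _ _ _ c (fun n => (14 * n + 20 + csz y0).+1)); first by solve_poly.
case=> [|a l] S; rewrite ?pcode_cons; apply: run_ifA.
  by apply: run_weak (run_pushes _ _ _ _ _) _; rewrite size_pcode /=; lia.
rewrite csz_cons.
apply: run_seqW (run_swap_tree _ _ _) (run_drop_tree _ _) _.
by lia.
Qed.

Lemma pt_behead X Y (cX : coded X) (cY : coded Y) (f : X -> seq Y) :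
  ptime f -> ptime (fun x => behead (f x)).
Proof.
apply: (pt_comp (f := (@behead Y))).
pose c := ifpop RA (Push RA false) drop_tree.
apply: (@ptimeI _ _ _ _ _ c (fun n => (7 * n + 10).+1)); first by solve_poly.
case=> [|a l] S; rewrite ?pcode_cons; apply: run_ifA.
  by apply: run_weak (run_push1 _) _.
rewrite csz_cons.
by apply: run_weak (run_drop_tree _ _) _; lia.
Qed.

(** The stack holds the rest of the list and, below it, the pair [(x, s)]; a leaf tag ends the loop
    and leaves the pair. The cost [K] is required only for accumulators that actually occur, hence
    the hypothesis on prefixes of [l]. *)
Lemma run_fold_loop X Y Z (cX : coded X) (cY : coded Y) (cZ : coded Z)
    (step : X -> Z -> Y -> Z) c x K S l s :
  let w := Loop RA Skip Skip (Seq (Push RA true) (Seq (Push RA true) (Seq c pop1))) false true in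
  (forall l1 a l2, l = l1 ++ a :: l2 ->
     let s1 := foldl (step x) s l1 in
     does c (code ((a, l2), (x, s1))) (code (l2, (x, step x s1 a))) K) ->
  run w (onA (pcode (code l) ++ pcode (code (x, s)) ++ S))
    (onA (pcode (code (x, foldl (step x) s l)) ++ S)) ((K + 5) * size l + 2).
Proof.
move=> w; elim: l s => [|a l IH] s hc.
  apply: (@run_weak _ _ _ 2); last by rewrite leq_addl.
  exact: (@run_exit RA _ _ _ _ _ false (pcode (code (x, s)) ++ S) (onA _) _ _ (erefl _) (erefl _)
    (run_skip _ 0)).
apply: (@run_weak _ _ _ ((1 + (1 + (K + 2))) + ((K + 5) * size l + 2)).+1); last first.
  by rewrite /= mulnS; lia.
have {IH} h2 := IH (step x s a) (fun l1 b l2 e => hc (a :: l1) b l2 (congr1 (cons a) e)).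
apply: (@run_loop RA _ _ _ _ _ true (pcode (code a) ++ pcode (code l) ++ pcode (code (x, s)) ++ S)
  _ _ _ _ _ _ (erefl _) _ h2); first by rewrite pcode_cons.
(* Two tags [true] turn the stack contents into the code of [((a, l), (x, s))]; after [c], removing
   one tag splits its result into a list and a pair again. *)
apply: run_seq (run_push1 (erefl _)) _; apply: run_seq (run_push1 (erefl _)) _.
have := hc [::] a l (erefl _) S; rewrite !pcode_pair => h.
exact: run_seq h (run_pop1 _ _ _ _ _).
Qed.

(** The last hypothesis excludes explosive growth: every intermediate accumulator stays below one
    polynomial [r], so each step costs at most a fixed polynomial [K]. *)
Lemma ptime_foldl X A B (cX : coded X) (cA : coded A) (cB : coded B)
    (step : X -> B -> A -> B) (s0 : X -> B) (l : X -> seq A) (r : nat -> nat) :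
  ptime (fun q : X * (B * A) => step q.1 q.2.1 q.2.2) -> ptime s0 -> ptime l ->
  polyb r ->
  (forall x i, csz (foldl (step x) (s0 x) (take i (l x))) <= r (csz x)) ->
  ptime (fun x => foldl (step x) (s0 x) (l x)).
Proof.
move=> hstep hs0 hl hr hb.
have [c [k hc]] : ptime (fun q : (A * seq A) * (X * B) =>
    (q.1.2, (q.2.1, step q.2.1 q.2.2 q.1.1))).
  apply: pt_pair; first by apply: pt_snd (pt_fst (pt_id _)).
  apply: pt_pair; first by apply: pt_fst (pt_snd (pt_id _)).
  apply: (pt_comp (g := fun q : (A * seq A) * (X * B) => (q.2.1, (q.2.2, q.1.1))) hstep).
  apply: pt_pair; first by apply: pt_fst (pt_snd (pt_id _)).
  apply: pt_pair; first by apply: pt_snd (pt_snd (pt_id _)).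
  by apply: pt_fst (pt_fst (pt_id _)).
have [ql hql hsl] := ptime_size hl.
have [ci [ki hi]] : ptime (fun x => (l x, (x, s0 x))).
  by apply: pt_pair => //; apply: pt_pair => //; apply: pt_id.
pose w := Loop RA Skip Skip (Seq (Push RA true) (Seq (Push RA true) (Seq c pop1))) false true.
pose K n := (ql n + (n + r n) + 10).+2 ^ k.
apply: (@ptimeI _ _ _ _ _ (Seq ci (Seq pop1 (Seq w snd_tree)))
  (fun n => n.+2 ^ ki + (2 + (((K n + 5) * ql n + 2) + (7 * n + 6))))).
  by rewrite /K; solve_poly.
have size_le (u : seq A) : size u <= csz u.
  by elim: u => // a u IH; rewrite csz_cons /=; lia.
move=> x S; apply: run_seq (hi _ _) _.
rewrite pcode_pair; apply: run_seq (run_pop1 _ _ _ _ _) _.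
have hsnd := does_snd (@code _ cX x) (@code _ cB (foldl (step x) (s0 x) (l x))) S.
apply: run_seq _ hsnd.
apply: (run_weak (t := (K (csz x) + 5) * size (l x) + 2)); last first.
  by rewrite leq_add2r leq_mul2l (leq_trans (size_le _) (hsl _)) orbT.
apply: run_fold_loop => l1 a l2 e s1; apply: does_weak (hc _) _.
rewrite /K; case: (k) => // k'; rewrite leq_exp2r // !csz_pair.
have h1 : csz s1 <= r (csz x).
  by have := hb x (size l1); rewrite e take_size_cat.
have h2 : csz (a :: l2) <= ql (csz x).
  apply: leq_trans (hsl x); rewrite e; elim: (l1) => // b u IH.
  by apply: leq_trans IH _; rewrite cat_cons !csz_cons; lia.
by rewrite csz_cons in h2; lia.
Qed.

(** When a step enlarges the accumulator by an amount depending on [x] and the list element only,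
    the total growth is at most the size of the list times a polynomial, as [ptime_foldl]
    requires. *)
Lemma pt_foldl X A B (cX : coded X) (cA : coded A) (cB : coded B)
    (step : X -> B -> A -> B) (s0 : X -> B) (l : X -> seq A) (r : nat -> nat) :
  ptime (fun q : X * (B * A) => step q.1 q.2.1 q.2.2) -> ptime s0 -> ptime l ->
  polyb r ->
  (forall x s a, csz (step x s a) <= csz s + r (csz x + csz a)) ->
  ptime (fun x => foldl (step x) (s0 x) (l x)).
Proof.
move=> hstep hs0 hl [k hk] hb.
have [ql hql hsl] := ptime_size hl; have [qs hqs hss] := ptime_size hs0.
apply: (@ptime_foldl _ _ _ _ _ _ _ _ _
  (fun n => qs n + ql n * (n + ql n).+2 ^ k)) => //; first by solve_poly.
move=> x i; apply: leq_trans (leq_add (hss x) (leqnn _)).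
have : csz (take i (l x)) <= ql (csz x).
  apply: leq_trans (hsl x); elim: (l x) i => [|a u IH] [|i] //.
  by rewrite [take _ _]/= !csz_cons; have := IH i; lia.
move: (take i (l x)) (s0 x) => u s hu.
have h : csz (foldl (step x) s u) <= csz s + csz u * (csz x + ql (csz x)).+2 ^ k; last first.
  by apply: leq_trans h _; rewrite leq_add2l leq_mul2r hu orbT.
elim: u s hu => [|a u IH] s; first by rewrite leq_addr.
rewrite !csz_cons [foldl _ _ _]/= => hu; have {}IH := IH (step x s a) (leq_trans (ltnW _) hu).
apply: leq_trans (IH _) _; first by lia.
have h1 : r (csz x + csz a) <= (csz x + ql (csz x)).+2 ^ k.
  by apply: leq_trans (hk _) _; case: (k) => // k'; rewrite leq_exp2r //; lia.
have h2 : (1 + csz u) * (csz x + ql (csz x)).+2 ^ k <=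
    (csz a + csz u).+1 * (csz x + ql (csz x)).+2 ^ k.
  by rewrite leq_mul2r; apply/orP; right; lia.
by have := hb x s a; lia.
Qed.

(** * Reading the input bits and writing the output bits *)

Definition read_input :=
  Seq (pour RA RB) (Seq (Push RA false)
    (while_pop RB (Seq (pushes (pcode (coded_bool false))) (Push RA true))
                  (Seq (pushes (pcode (coded_bool true))) (Push RA true)))).

(** Consing the bits in tape order builds the list in reverse, so the program receives [rev w] as
    its argument. *)
Lemma run_read_input w :
  run read_input (onA (rev w)) (onA (pcode (code (rev w)))) (12 * size w + 6).
Proof.
rewrite /read_input; set loop := while_pop RB _ _.
have h (u l : seq bool) : run loop (Store (pcode (code l)) u [::] [::])
    (onA (pcode (code (catrev u l)))) (10 * size u + 2).
  elim: u l => [|b u IH] l; first exact: run_while_end.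
  apply: (@run_weak _ _ _ (8 + (10 * size u + 2)).+1); last by rewrite /=; lia.
  apply: run_whileB (IH (b :: l)).
  by case: b; apply: run_seqW (run_pushes _ _ _ _ _) (run_push1 (erefl _)) _.
apply: run_seqW (run_pourAB _ _ _ _) _ _; last first.
  by instantiate (1 := 10 * size w + 3); rewrite size_rev; lia.
apply: run_seqW (run_push1 (erefl _)) _ _; last first.
  by instantiate (1 := 10 * size w + 2); lia.
by have := h w [::]; rewrite /= !catrevE revK !cats0.
Qed.

Definition write_output :=
  Seq (Loop RA Skip Skip
        (Seq pop1 (ifpop RA (Seq pop3 (Push RB false)) (Seq pop3 (Push RB true)))) false true)
    (Seq (pour RB RC) (pour RC RA)).

Lemma run_write_output (o : seq bool) :
  run write_output (onA (pcode (code o))) (onA (rev o)) (15 * size o + 6).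
Proof.
have h l B : run (Loop RA Skip Skip
        (Seq pop1 (ifpop RA (Seq pop3 (Push RB false)) (Seq pop3 (Push RB true)))) false true)
    (Store (pcode (code l)) B [::] [::]) (Store [::] (catrev l B) [::] [::]) (11 * size l + 2).
  elim: l B => [|b l IH] B.
    apply: (@run_weak _ _ _ 2) => //.
    exact: (@run_exit RA _ _ _ _ _ false [::] (Store _ B _ _) _ _ (erefl _) (erefl _)
      (run_skip _ 0)).
  apply: (@run_weak _ _ _ (10 + (11 * size l + 2)).+1); last by rewrite /=; lia.
  apply: (@run_loop RA _ _ _ _ _ true (pcode (code b) ++ pcode (code l)) _ _ _ _ _
    _ _ _ (IH (b :: B))) => //.
  apply: (run_seqW (t1 := 2) (t2 := 8)
    (s2 := Store [:: b, ~~ b, false, false & pcode (code l)] B [::] [::])) => //.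
    by case: b; apply: run_pop1.
  apply: run_ifA.
  by case: b; apply: run_seqW (run_pop3 _ _ _ _ _ _ _) (run_push1 (erefl _)) _.
apply: run_seqW (h _ _) _ _; last first.
  by instantiate (1 := 4 * size o + 4); lia.
apply: run_seqW (run_pourBC _ _ _ _) _ _; last first.
  by instantiate (1 := 2 * size o + 2); rewrite catrevE cats0 size_rev; lia.
have := run_pourCA [::] [::] (catrev (catrev o [::]) [::]) [::].
by rewrite !catrevE !cats0 !revK.
Qed.

Lemma csz_bits (w : seq bool) : csz w = 6 * size w + 1.
Proof. by elim: w => // b w IH; rewrite csz_cons IH; case: b; rewrite /=; lia. Qed.

(** The code of [x] is that of its reversed input bits and has size [6 * size (w x) + 1], so
    polynomial in the code means polynomial in the input length. The cost [T] on stacks becomes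
    quadratically larger on the tape. *)
Theorem ptime_machine X (w : X -> seq bool) (f : X -> seq bool) :
  ptime (cX := fun x => code (rev (w x))) f ->
  exists (M : TM) (k : nat), forall x, exists t (cf : config M),
    [/\ t <= (size (w x)).+2 ^ k, exec t (init M (w x)) = Some cf & output cf = f x].
Proof.
move=> hf; have [q hq hs] := ptime_size hf; case: hf => c [k hc].
pose p := Seq read_input (Seq c write_output).
pose T n := (12 * n + 6) + ((6 * n + 1).+2 ^ k + (15 * q (6 * n + 1) + 6)).
have hT : polyb (fun n => 2 + T n * (2 * (n + T n) + 4)) by rewrite /T; solve_poly.
case: hT => e he; exists (machine (compile p 0 (len p))), e => x.
have hw : csz (rev (w x)) = 6 * size (w x) + 1 by rewrite csz_bits size_rev.
have hrun : run p (onA (rev (w x))) (onA (rev (f x))) (T (size (w x))).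
  apply: run_seq (run_read_input _) _.
  have := hc x [::]; rewrite !cats0 [code x]/(code (rev (w x))) hw => h; apply: run_seq h _.
  apply: run_weak (run_write_output _) _; rewrite leq_add2r leq_mul2l /=.
  by have := hs x; rewrite [code x]/(code (rev (w x))) hw csz_bits; lia.
have [t [cf [h1 h2 h3]]] := simulate hrun.
exists t, cf; split=> //; last by rewrite h3 revK.
by apply: leq_trans h1 (he _).
Qed.

(** * Lists and binary arithmetic *)

Arguments code : simpl never.
Arguments sz : simpl never.

Lemma pt_code X Y (cX : coded X) (cY : coded Y) (f : X -> Y) :
  ptime f -> ptime (fun x => code (f x)).
Proof. by []. Qed.

(** A hook, rebound with [::=] whenever a further group of closure lemmas is available; [pt] then
    recurses through these as well. *)
Ltac pt_more := fail.
Ltac pt :=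
  lazymatch goal with
  | |- @ptime ?X ?Y ?cX ?cY ?f => change (@ptime X Y cX cY (fun x => f x)); cbv beta
  end;
  first
  [ assumption
  | match goal with |- ptime (fun _ => ?c) => exact (pt_const _ _ c) end
  | exact (pt_id _)
  | lazymatch goal with
    | |- ptime (fun x => (_, _)) => apply: pt_pair; pt
    | |- ptime (fun x => fst _) => apply: pt_fst; pt
    | |- ptime (fun x => snd _) => apply: pt_snd; pt
    | |- ptime (fun x => if _ then _ else _) => apply: pt_if; pt
    | |- ptime (fun x => _ :: _) => apply: pt_cons; pt
    | |- ptime (fun x => nilp _) => apply: pt_nilp; pt
    | |- ptime (fun x => head _ _) => apply: pt_head; pt
    | |- ptime (fun x => behead _) => apply: pt_behead; pt
    | |- ptime (fun x => code _) => apply: pt_code; pt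
    end
  | pt_more
  | match goal with H : ptime _ |- _ => apply: (pt_comp H); pt end ].

Lemma csz_nil A {cA : coded A} : csz ([::] : seq A) = 1. Proof. by []. Qed.

Lemma csz_bool (b : bool) : csz b = 5. Proof. by case: b. Qed.

Section Boolean.
Context X (cX : coded X).
Implicit Types b : X -> bool.

Lemma pt_negb b : ptime b -> ptime (fun x => ~~ b x).
Proof.
move=> h; apply: (@ptime_ext _ _ _ _ (fun x => if b x then false else true)); last by pt.
by move=> x; case: (b x).
Qed.

Lemma pt_andb b1 b2 : ptime b1 -> ptime b2 -> ptime (fun x => b1 x && b2 x).
Proof.
move=> h1 h2; apply: (@ptime_ext _ _ _ _ (fun x => if b1 x then b2 x else false)); last by pt.
by move=> x; case: (b1 x).
Qed.

Lemma pt_orb b1 b2 : ptime b1 -> ptime b2 -> ptime (fun x => b1 x || b2 x).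
Proof.
move=> h1 h2; apply: (@ptime_ext _ _ _ _ (fun x => if b1 x then true else b2 x)); last by pt.
by move=> x; case: (b1 x).
Qed.

Lemma pt_addb b1 b2 : ptime b1 -> ptime b2 -> ptime (fun x => b1 x (+) b2 x).
Proof.
move=> h1 h2; apply: (@ptime_ext _ _ _ _ (fun x => if b1 x then ~~ b2 x else b2 x)).
  by move=> x; case: (b1 x).
by apply: pt_if => //; apply: pt_negb.
Qed.
End Boolean.

Ltac pt_bool :=
  lazymatch goal with
  | |- ptime (fun x => ~~ _) => apply: pt_negb; pt
  | |- ptime (fun x => _ && _) => apply: pt_andb; pt
  | |- ptime (fun x => _ || _) => apply: pt_orb; pt
  | |- ptime (fun x => _ (+) _) => apply: pt_addb; pt
  end.

Ltac pt_more ::= pt_bool.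

Lemma pt_rev X A (cX : coded X) (cA : coded A) (l : X -> seq A) :
  ptime l -> ptime (fun x => rev (l x)).
Proof.
move=> hl; apply: (@ptime_ext _ _ _ _ (fun x => foldl (fun s a => a :: s) [::] (l x))).
  by move=> x; rewrite -[RHS]cats0 -catrevE; elim: (l x) [::] => //= a u IH s.
apply: (@pt_foldl _ _ _ _ _ _ (fun _ s a => a :: s) (fun=> [::]) _ (fun n => n.+1)) => //; try pt.
  by solve_poly.
by move=> x s a; rewrite csz_cons; lia.
Qed.

Lemma pt_foldr X A B (cX : coded X) (cA : coded A) (cB : coded B)
    (step : X -> A -> B -> B) (s0 : X -> B) (l : X -> seq A) (r : nat -> nat) :
  ptime (fun q : X * (A * B) => step q.1 q.2.1 q.2.2) -> ptime s0 -> ptime l ->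
  polyb r ->
  (forall x s a, csz (step x a s) <= csz s + r (csz x + csz a)) ->
  ptime (fun x => foldr (step x) (s0 x) (l x)).
Proof.
move=> hstep hs0 hl hr hb.
apply: (@ptime_ext _ _ _ _ (fun x => foldl (fun s a => step x a s) (s0 x) (rev (l x)))).
  by move=> x; rewrite foldl_rev.
apply: (@pt_foldl _ _ _ _ _ _ (fun x s a => step x a s) _ _ r) => //; last exact: pt_rev.
by apply: (pt_comp (g := fun q : X * (B * A) => (q.1, (q.2.2, q.2.1))) hstep); pt.
Qed.

Lemma pt_cat X A (cX : coded X) (cA : coded A) (l1 l2 : X -> seq A) :
  ptime l1 -> ptime l2 -> ptime (fun x => l1 x ++ l2 x).
Proof.
move=> h1 h2; apply: (@ptime_ext _ _ _ _ (fun x => foldr (fun a s => a :: s) (l2 x) (l1 x))).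
  by move=> x; elim: (l1 x) => //= a u ->.
apply: (@pt_foldr _ _ _ _ _ _ (fun _ a s => a :: s) _ _ (fun n => n.+1)) => //; try pt.
  by solve_poly.
by move=> x s a; rewrite csz_cons; lia.
Qed.

Lemma pt_map X A B (cX : coded X) (cA : coded A) (cB : coded B)
    (f : X -> A -> B) (l : X -> seq A) :
  ptime (fun q : X * A => f q.1 q.2) -> ptime l -> ptime (fun x => map (f x) (l x)).
Proof.
move=> hf hl; have [q hq hs] := ptime_size hf.
apply: (@ptime_ext _ _ _ _ (fun x => foldr (fun a s => f x a :: s) [::] (l x))) => //.
apply: (@pt_foldr _ _ _ _ _ _ (fun x a s => f x a :: s) _ _ (fun n => (q n.+1).+1)) => //.
- apply: pt_cons; last by pt.
  by apply: (pt_comp (g := fun p : X * (A * seq B) => (p.1, p.2.1)) hf); pt.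
- by pt.
- by apply: polyb_S; apply: (polyb_comp hq); solve_poly.
- by move=> x s a; rewrite csz_cons; have := hs (x, a); rewrite csz_pair /=; lia.
Qed.

Lemma pt_filter X A (cX : coded X) (cA : coded A) (p : X -> A -> bool) (l : X -> seq A) :
  ptime (fun q : X * A => p q.1 q.2) -> ptime l -> ptime (fun x => filter (p x) (l x)).
Proof.
move=> hp hl.
apply: (@ptime_ext _ _ _ _
  (fun x => foldr (fun a s => if p x a then a :: s else s) [::] (l x))) => //.
apply: (@pt_foldr _ _ _ _ _ _ (fun x a s => if p x a then a :: s else s) _ _
  (fun n => n.+1)) => //.
- apply: pt_if; [|by pt|by pt].
  by apply: (pt_comp (g := fun p : X * (A * seq A) => (p.1, p.2.1)) hp); pt.
- by pt.
- by solve_poly.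
- by move=> x s a; case: ifP => _; rewrite ?csz_cons; lia.
Qed.

Lemma pt_has X A (cX : coded X) (cA : coded A) (p : X -> A -> bool) (l : X -> seq A) :
  ptime (fun q : X * A => p q.1 q.2) -> ptime l -> ptime (fun x => has (p x) (l x)).
Proof.
move=> hp hl.
apply: (@ptime_ext _ _ _ _ (fun x => ~~ nilp (filter (p x) (l x)))).
  by move=> x; rewrite /nilp size_filter has_count lt0n.
by apply: pt_negb; apply: pt_nilp; apply: pt_filter.
Qed.

Lemma pt_all X A (cX : coded X) (cA : coded A) (p : X -> A -> bool) (l : X -> seq A) :
  ptime (fun q : X * A => p q.1 q.2) -> ptime l -> ptime (fun x => all (p x) (l x)).
Proof.
move=> hp hl.
apply: (@ptime_ext _ _ _ _ (fun x => ~~ has (fun a => ~~ p x a) (l x))).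
  by move=> x; rewrite -[RHS]negbK -has_predC.
apply: pt_negb; apply: (pt_has (p := fun x a => ~~ p x a)) => //.
exact: pt_negb.
Qed.

Lemma csz_cat A {cA : coded A} (l1 l2 : seq A) : csz (l1 ++ l2) <= csz l1 + csz l2.
Proof. by elim: l1 => [|a l1 IH]; rewrite ?cat_cons ?csz_cons //; lia. Qed.

Lemma pt_flatmap X A B (cX : coded X) (cA : coded A) (cB : coded B)
    (f : X -> A -> seq B) (l : X -> seq A) :
  ptime (fun q : X * A => f q.1 q.2) -> ptime l ->
  ptime (fun x => flatten (map (f x) (l x))).
Proof.
move=> hf hl; have [q hq hs] := ptime_size hf.
apply: (@ptime_ext _ _ _ _ (fun x => foldr (fun a s => f x a ++ s) [::] (l x))).
  by move=> x; rewrite /flatten foldr_map.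
apply: (@pt_foldr _ _ _ _ _ _ (fun x a s => f x a ++ s) _ _ (fun n => q n.+1)) => //.
- apply: pt_cat; last by pt.
  by apply: (pt_comp (g := fun p : X * (A * seq B) => (p.1, p.2.1)) hf); pt.
- by pt.
- by apply: (polyb_comp hq); solve_poly.
- move=> x s a; apply: leq_trans (csz_cat _ _) _.
  by have := hs (x, a); rewrite csz_pair /=; lia.
Qed.

Lemma csz_behead A {cA : coded A} (l : seq A) : csz (behead l) <= csz l.
Proof. by case: l => // a l; rewrite csz_cons /=; lia. Qed.

Lemma pt_zip X A B (cX : coded X) (cA : coded A) (cB : coded B)
    (b0 : B) (l1 : X -> seq A) (l2 : X -> seq B) :
  ptime l1 -> ptime l2 -> ptime (fun x => zip (l1 x) (l2 x)).
Proof.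
move=> h1 h2.
pose step (s : seq B * seq (A * B)) (a : A) :=
  if nilp s.1 then s else (behead s.1, (a, head b0 s.1) :: s.2).
apply: (@ptime_ext _ _ _ _ (fun x => rev (foldl step (l2 x, [::]) (l1 x)).2)).
  move=> x; rewrite -[RHS]cat0s -[X in X ++ _]/(rev [::]).
  elim: (l1 x) (l2 x) [::] => [|a u IH] [|b v] s //=; rewrite ?cats0 //.
    by rewrite IH; case: (u) => *; rewrite cats0.
  by rewrite IH rev_cons cat_rcons.
apply: pt_rev; apply: pt_snd.
apply: (@pt_foldl _ _ _ _ _ _ (fun _ => step) (fun x => (l2 x, [::])) _ (fun n => n + 20)) => //.
- by rewrite /step; pt.
- by pt.
- by solve_poly.
- move=> x [v s] a; rewrite /step; case: v => [|b v] /=; first by lia.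
  by rewrite (csz_pair v) (csz_pair (b :: v)) !csz_cons (csz_pair a); lia.
Qed.

(** * Arithmetic on binary numerals, least significant bit first *)

Fixpoint bval (l : seq bool) : nat := if l is b :: l' then b + (bval l').*2 else 0.

Lemma bits_aux_fuel f g n : n <= f -> n <= g -> bits_aux f n = bits_aux g n.
Proof.
elim: f g n => [|f IH] [|g] [|n] //= hf hg; congr (_ :: _).
by apply: IH; lia.
Qed.

Lemma bits_double (b : bool) n : (b : nat) + n.*2 != 0 -> bits (b + n.*2) = b :: bits n.
Proof.
move=> h; have [m hm] : exists m, b + n.*2 = m.+1 by exists (b + n.*2).-1; lia.
rewrite /bits {1}hm /= (negPf h) half_bit_double oddD odd_double addbF; congr (_ :: _).
  by case: (b).
by apply: bits_aux_fuel; lia.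
Qed.

Lemma bvalK n : bval (bits n) = n.
Proof.
elim: n {-2}n (leqnn n) => [|n IH] m hm; first by case: m hm.
case: (posnP m) => [->//|h]; rewrite -(odd_double_half m) bits_double /=.
  by rewrite IH //; lia.
by rewrite odd_double_half -lt0n.
Qed.

Lemma size_bits_le n k : (size (bits n) <= k) = (n < 2 ^ k).
Proof.
elim: k n => [|k IH] n.
  case: (posnP n) => [->//|h]; rewrite -(odd_double_half n) bits_double /=; first by lia.
  by rewrite odd_double_half -lt0n.
case: (posnP n) => [->|h]; first by rewrite expn_gt0.
rewrite -{1}(odd_double_half n) bits_double /=; last by rewrite odd_double_half -lt0n.
by rewrite ltnS IH expnS; lia.
Qed.

Lemma size_bits_add m n : size (bits (m + n)) <= (size (bits m) + size (bits n)).+1.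
Proof.
rewrite size_bits_le expnS expnD.
have := leqnn (size (bits m)); rewrite {1}size_bits_le.
have := leqnn (size (bits n)); rewrite {1}size_bits_le.
have : 0 < 2 ^ size (bits m) by rewrite expn_gt0.
have : 0 < 2 ^ size (bits n) by rewrite expn_gt0.
by move: (2 ^ _) (2 ^ _) => a b; nia.
Qed.

Lemma csz_nat n : csz n = 6 * size (bits n) + 1.
Proof. exact: (csz_bits (bits n)). Qed.

Lemma csz_add m n : csz (m + n) <= csz m + csz n + 5.
Proof. by rewrite !csz_nat; have := size_bits_add m n; lia. Qed.

(** A full adder: the new carry is the majority of both digits and the old carry. The ignored
    argument is a clock, as programs loop only by folding over a list. *)
Definition add_step (st : bool * (seq bool * (seq bool * seq bool))) (_ : bool) :=
  let x := head false st.2.1 in let y := head false st.2.2.1 in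
  (if x then y || st.1 else y && st.1,
   (behead st.2.1, (behead st.2.2.1, (x (+) y (+) st.1) :: st.2.2.2))).

(** The digits already produced lie in [o], most significant first, and [c + bval a + bval b] is the
    part of the sum still to be written; so it is the initial value for reading [o]. The strict
    inequalities provide the extra tick that writes the last carry. *)
Lemma add_stepP fl c a b o : size a < size fl -> size b < size fl ->
  foldl (fun v (x : bool) => x + v.*2) 0
    (foldl add_step (c, (a, (b, o))) fl).2.2.2
  = foldl (fun v (x : bool) => x + v.*2) (c + bval a + bval b) o.
Proof.
elim: fl c a b o => [|f fl IH] c a b o //=; rewrite !ltnS => ha hb.
pose x := head false a; pose y := head false b.
pose c' := if x then y || c else y && c; pose z := x (+) y (+) c.
rewrite -[add_step _ _]/(c', (behead a, (behead b, z :: o))).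
case: fl IH ha hb => [|g fl] IH ha hb.
  by case: a b ha hb @x @y @c' @z => [|? ?] [|? ?] //= _ _; case: c.
rewrite IH; [|by case: (a) ha|by case: (b) hb].
rewrite /=; congr foldl; rewrite /c' /z /x /y.
by case: (a) => [|[] u]; case: (b) => [|[] v]; case: c {c' z} => /=; lia.
Qed.

Definition normalize l :=
  foldl (fun acc (x : bool) => if ~~ x && nilp acc then [::] else x :: acc) [::] l.

Lemma normalizeE l : normalize l = bits (foldl (fun v (x : bool) => x + v.*2) 0 l).
Proof.
rewrite /normalize -[X in foldl _ X]/(bits 0); elim: l 0 => //= x l IH v.
rewrite -IH; congr foldl.
case: (posnP v) => [->|hv]; first by case: x.
rewrite bits_double -?lt0n; last by lia.
by rewrite -(odd_double_half v) bits_double ?andbF // odd_double_half -lt0n.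
Qed.

Definition add_bits (a b : seq bool) :=
  normalize (foldl add_step (false, (a, (b, [::]))) (true :: a ++ b)).2.2.2.

Lemma add_bitsE m n : add_bits (bits m) (bits n) = bits (m + n).
Proof.
by rewrite /add_bits normalizeE add_stepP /= ?size_cat ?ltnS ?leq_addr ?leq_addl // !bvalK.
Qed.

Definition leq_step (st : bool * (seq bool * seq bool)) (_ : bool) :=
  let x := head false st.2.1 in let y := head false st.2.2 in
  (if x then (if y then st.1 else y) else (if y then y else st.1),
   (behead st.2.1, behead st.2.2)).

(** Digits arrive least significant first, so an unequal pair overrides the verdict [r] of the lower
    digits and an equal pair keeps it. *)
Lemma leq_stepP fl r a b : size a <= size fl -> size b <= size fl ->
  (foldl leq_step (r, (a, b)) fl).1 = if bval a == bval b then r else bval a < bval b.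
Proof.
elim: fl r a b => [|f fl IH] r a b; first by case: a; case: b.
move=> ha hb; pose x := head false a; pose y := head false b.
pose r' := if x then (if y then r else y) else (if y then y else r).
rewrite [foldl _ _ _]/= -[leq_step _ _]/(r', (behead a, behead b)).
rewrite IH; [|by case: (a) ha|by case: (b) hb].
have eA (l : seq bool) : bval l = head false l + (bval (behead l)).*2 by case: l.
rewrite (eA a) (eA b) /r' /x /y.
by case: (head false a); case: (head false b) => /=; case: eqP; case: eqP; lia.
Qed.

Lemma leq_bitsE m n :
  (foldl leq_step (true, (bits m, bits n)) (bits m ++ bits n)).1 = (m <= n).
Proof.
rewrite leq_stepP ?size_cat ?leq_addr ?leq_addl // !bvalK.
by case: ltngtP.
Qed.

Section Arithmetic.
Context X (cX : coded X).
Implicit Types m n : X -> nat.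

Lemma pt_bits n : ptime n -> ptime (fun x => bits (n x)).
Proof. by []. Qed.

Lemma pt_of_bits n : ptime (fun x => bits (n x)) -> ptime n.
Proof. by []. Qed.

Lemma pt_addn m n : ptime m -> ptime n -> ptime (fun x => m x + n x).
Proof.
move=> hm hn; apply: pt_of_bits.
apply: (@ptime_ext _ _ _ _ (fun x => add_bits (bits (m x)) (bits (n x)))).
  by move=> x; rewrite add_bitsE.
have {}hm := pt_bits hm; have {}hn := pt_bits hn.
rewrite /add_bits /normalize.
apply: (@pt_foldl _ _ _ _ _ _
  (fun _ acc (x : bool) => if ~~ x && nilp acc then [::] else x :: acc)
  (fun=> [::]) _ (fun k => k + 10)) => //; [by pt|by pt| |by solve_poly|].
  apply: pt_snd; apply: pt_snd; apply: pt_snd.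
  apply: (@pt_foldl _ _ _ _ _ _ (fun _ => add_step)
    (fun x => (false, (bits (m x), (bits (n x), [::])))) _ (fun k => k + 10)) => //.
  - by rewrite /add_step; pt.
  - by pt.
  - by apply: pt_cons; [pt|apply: pt_cat].
  - by solve_poly.
  - move=> x [c [a [b o]]] f; rewrite /add_step /=.
    rewrite !(csz_pair _ (_, _)) !(csz_pair (behead b)) !(csz_pair b).
    rewrite !csz_cons !csz_bool.
    by have := @csz_behead _ coded_bool a; have := @csz_behead _ coded_bool b; lia.
move=> x s a; case: ifP => _; last by rewrite csz_cons csz_bool; lia.
by rewrite csz_nil; have := sz_gt0 (code s); lia.
Qed.

Lemma pt_leq m n : ptime m -> ptime n -> ptime (fun x => m x <= n x).
Proof.
move=> hm hn.
apply: (@ptime_ext _ _ _ _ (fun x =>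
  (foldl leq_step (true, (bits (m x), bits (n x))) (bits (m x) ++ bits (n x))).1)).
  by move=> x; rewrite leq_bitsE.
have {}hm := pt_bits hm; have {}hn := pt_bits hn.
apply: pt_fst.
apply: (@pt_foldl _ _ _ _ _ _ (fun _ => leq_step)
  (fun x => (true, (bits (m x), bits (n x)))) _ (fun k => k)) => //.
- by rewrite /leq_step; pt.
- by pt.
- by apply: pt_cat.
- by solve_poly.
- move=> x [c [a b]] f; rewrite /leq_step /= !(csz_pair _ (_, _)) !csz_bool.
  rewrite (csz_pair (behead a)) (csz_pair a).
  by have := @csz_behead _ coded_bool a; have := @csz_behead _ coded_bool b; lia.
Qed.

Lemma pt_eqn m n : ptime m -> ptime n -> ptime (fun x => m x == n x).
Proof.
move=> hm hn; apply: (@ptime_ext _ _ _ _ (fun x => (m x <= n x) && (n x <= m x))).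
  by move=> x; rewrite eqn_leq.
by apply: pt_andb; apply: pt_leq.
Qed.

Lemma pt_succ n : ptime n -> ptime (fun x => (n x).+1).
Proof.
move=> hn; apply: (@ptime_ext _ _ _ _ (fun x => n x + 1)); first by move=> x; rewrite addn1.
by apply: pt_addn => //; apply: pt_const.
Qed.
End Arithmetic.

Ltac pt_arith :=
  lazymatch goal with
  | |- ptime (fun x => S _) => apply: pt_succ; pt
  | |- ptime (fun x => _ + _) => apply: pt_addn; pt
  | |- ptime (fun x => leq _ _) => apply: pt_leq; pt
  | |- ptime (fun x => _ == _) => apply: pt_eqn; pt
  | |- _ => pt_bool
  end.

Ltac pt_more ::= pt_arith.

Lemma pt_count X A (cX : coded X) (cA : coded A) (p : X -> A -> bool) (l : X -> seq A) :
  ptime (fun q : X * A => p q.1 q.2) -> ptime l -> ptime (fun x => count (p x) (l x)).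
Proof.
move=> hp hl.
apply: (@ptime_ext _ _ _ _
  (fun x => foldr (fun a s => if p x a then s.+1 else s) 0 (l x))).
  by move=> x; elim: (l x) => //= a u ->; case: (p x a).
apply: (@pt_foldr _ _ _ _ _ _ (fun x a s => if p x a then s.+1 else s) _ _
  (fun n => n + 20)) => //.
- apply: pt_if; [|by pt|by pt].
  by apply: (pt_comp (g := fun p : X * (A * nat) => (p.1, p.2.1)) hp); pt.
- by pt.
- by solve_poly.
- move=> x s a; case: ifP => _; last by rewrite leq_addr.
  by rewrite -addn1; apply: leq_trans (csz_add _ _) _; have -> : csz 1 = 7 by []; lia.
Qed.

Lemma pt_mem X (cX : coded X) (n : X -> nat) (l : X -> seq nat) :
  ptime n -> ptime l -> ptime (fun x => n x \in l x).
Proof.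
move=> hn hl; apply: (@ptime_ext _ _ _ _ (fun x => has (fun a => a == n x) (l x))).
  by move=> x; rewrite has_pred1.
apply: (pt_has (p := fun x a => a == n x)) => //.
by apply: pt_eqn; [pt|apply: (pt_comp hn); pt].
Qed.

Lemma pt_sum X A (cX : coded X) (cA : coded A) (f : X -> A -> nat) (l : X -> seq A) :
  ptime (fun q : X * A => f q.1 q.2) -> ptime l ->
  ptime (fun x => foldr (fun a s => f x a + s) 0 (l x)).
Proof.
move=> hf hl; have [q hq hs] := ptime_size hf.
apply: (@pt_foldr _ _ _ _ _ _ (fun x a s => f x a + s) _ _ (fun n => q n.+1 + 5)) => //.
- apply: pt_addn; last by pt.
  by apply: (pt_comp (g := fun p : X * (A * nat) => (p.1, p.2.1)) hf); pt.
- by pt.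
- by apply: polyb_add; [apply: (polyb_comp hq)|]; solve_poly.
- move=> x s a; apply: leq_trans (csz_add _ _) _.
  by have := hs (x, a); rewrite csz_pair /=; lia.
Qed.

Ltac pt_list :=
  lazymatch goal with
  | |- ptime (fun x => _ ++ _) => apply: pt_cat; pt
  | |- ptime (fun x => rev _) => apply: pt_rev; pt
  | |- ptime (fun x => map _ _) => apply: pt_map; pt
  | |- ptime (fun x => filter _ _) => apply: pt_filter; pt
  | |- ptime (fun x => has _ _) => apply: pt_has; pt
  | |- ptime (fun x => all _ _) => apply: pt_all; pt
  | |- ptime (fun x => flatten _) => apply: pt_flatmap; pt
  | |- ptime (fun x => count _ _) => apply: pt_count; pt
  | |- ptime (fun x => _ \in _) => apply: pt_mem; pt
  | |- ptime (fun x => Node _ _) => apply: pt_node; pt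
  | |- ptime (fun x => left_child _) => apply: pt_left_child; pt
  | |- _ => pt_arith
  end.

Ltac pt_more ::= pt_list.

(** * The algorithm *)

Notation item := ((nat * nat) * nat)%type.
(** A sign flag and an absolute value. The final [unit] is coded by a leaf, so nested pairs of this
    shape have the same codes as the lists that the parser delivers. *)
Notation value := (nat * (nat * unit))%type.

(* The input is parsed from its last bit to its first one, so that the elements
   of a list are met in the order in which the list is built. *)
Definition token (b1 b2 : bool) (st : seq tree) : seq tree :=
  if b1 then
    if b2 then Leaf :: st
    else Node (head Leaf st) (head Leaf (behead st)) :: behead (behead st)
  else Node (code b2) (head Leaf st) :: behead st.

(** The bits of a token arrive second bit first, so the bit kept in [st.1] is the second one. Each
    tree on [st.2] is a list still under construction. *)
Definition parse_step (st : seq bool * seq tree) (b : bool) :=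
  if nilp st.1 then ([:: b], st.2) else ([::], token b (head false st.1) st.2).

Definition parse_tree (w : seq bool) : tree :=
  left_child (head Leaf (foldl parse_step ([::], [:: Leaf]) w).2).

(** [enc] brackets a number as if it were a list of bits, and the code of a number is the code of
    its bit list; so one untyped parser serves both. *)
Fixpoint tree_of_data (x : data) : tree :=
  match x with
  | DNat n => code n
  | DList l => code (map tree_of_data l)
  end.

Lemma rev_brackets (u : seq bool) :
  rev ([:: true; false] ++ u ++ [:: true; true])
  = [:: true; true] ++ rev u ++ [:: false; true].
Proof. by rewrite !rev_cat catA. Qed.

Lemma parse_data x l st :
  foldl parse_step ([::], l :: st) (rev (enc x)) = ([::], Node (tree_of_data x) l :: st).
Proof.
(* [data] is nested in [seq], so its generated induction principle says nothing about the members of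
   a list; hence the explicit [fix]. *)
move: x l st; fix IH 1; case=> [n|u] l st; rewrite [enc _]/= -2!cat_cons rev_brackets.
  have h : foldl parse_step ([::], [:: Leaf, l & st])
    (rev (flatten [seq [:: false; b] | b <- bits n])) = ([::], [:: code (bits n), l & st]); last first.
    by rewrite !foldl_cat h.
  elim: (bits n) => [|b v IHv]; first exact: erefl.
  rewrite [map _ _]/= [flatten _]/=.
  by rewrite !rev_cons -!cats1 -catA foldl_cat IHv.
have h : foldl parse_step ([::], [:: Leaf, l & st]) (rev (flatten (map enc u)))
  = ([::], [:: code (map tree_of_data u), l & st]); last first.
  by rewrite !foldl_cat h.
elim: u => [|y u IHu]; first exact: erefl.
rewrite [map enc _]/= [flatten _]/= rev_cat foldl_cat IHu.
exact: IH.
Qed.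

Lemma parse_enc x : parse_tree (rev (enc x)) = tree_of_data x.
Proof.
by rewrite /parse_tree parse_data. Qed.

Lemma csz_split (st : seq tree) : csz (head Leaf st) + csz (behead st) <= csz st + 1.
Proof. by case: st => [|t st] //; rewrite csz_cons /=; lia. Qed.

Lemma csz_node (a b : tree) : csz (Node a b) = (csz a + csz b).+1.
Proof. by []. Qed.

Lemma pt_parse : ptime parse_tree.
Proof.
rewrite /parse_tree; apply: pt_left_child; apply: pt_head; apply: pt_snd.
apply: (@pt_foldl _ _ _ _ _ _ (fun _ => parse_step) (fun=> ([::], [:: Leaf])) _
  (fun n => n + 20)) => //.
- by rewrite /parse_step /token; pt.
- by pt.
- by pt.
- by solve_poly.
- move=> x [u st] b; rewrite /parse_step /token /=.
  have hL : csz Leaf = 1 by [].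
  have h1 := csz_split st; have h2 := csz_split (behead st).
  case: u => [|b2 u]; rewrite [nilp _]/=; first by rewrite !csz_pair csz_cons csz_bool; lia.
  rewrite !csz_pair csz_nil; case: b; rewrite ?csz_cons ?csz_bool.
    by case: b2; rewrite csz_cons ?csz_node //; lia.
  by rewrite csz_node [head _ (_ :: _)]/=; have -> : csz (code b2) = 5; [by case: (b2)|lia].
Qed.

Lemma csz_nat_le n : csz n <= 6 * n + 1.
Proof. by rewrite csz_nat leq_add2r leq_mul2l size_bits_le ltn_expl. Qed.

Lemma csz_all A {cA : coded A} (l : seq A) m :
  all (fun a => csz a <= m) l -> csz l <= size l * m.+1 + 1.
Proof.
elim: l => //= a l IH /andP[ha /IH h]; rewrite csz_cons mulSn; lia.
Qed.

Lemma size_le_csz A {cA : coded A} (l : seq A) : size l <= csz l.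
Proof. by elim: l => // a l IH; rewrite csz_cons /=; lia. Qed.

Lemma csz_mem (A : eqType) {cA : coded A} (l : seq A) a : a \in l -> csz a <= csz l.
Proof.
elim: l => // b l IH; rewrite inE csz_cons => /orP[/eqP ->|/IH]; lia.
Qed.

(** Numbers are in binary, so [iota 0 n] may be exponentially larger than [n], whereas the length of
    a list is bounded by the size of its code. The counter grows along the loop, so the accumulator
    is bounded explicitly. *)
Lemma pt_iota X A (cX : coded X) (cA : coded A) (l : X -> seq A) :
  ptime l -> ptime (fun x => iota 0 (size (l x))).
Proof.
move=> hl; have [q hq hs] := ptime_size hl.
pose step (st : nat * seq nat) (_ : A) := (st.1.+1, st.1 :: st.2).
have E (u : seq A) : foldl step (0, [::]) u = (size u, rev (iota 0 (size u))).
  elim/last_ind: u => // u a IH.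
  by rewrite foldl_rcons IH size_rcons -addn1 iotaD rev_cat addn1.
apply: (@ptime_ext _ _ _ _ (fun x => rev (foldl step (0, [::]) (l x)).2)).
  by move=> x; rewrite E revK.
apply: pt_rev; apply: pt_snd.
apply: (@ptime_foldl _ _ _ _ _ _ (fun _ => step) (fun=> (0, [::])) _
  (fun n => (6 * q n + 1) + (q n * (6 * q n + 1).+1 + 1) + 1)) => //.
- by rewrite /step; pt.
- by pt.
- by solve_poly.
move=> x i; rewrite E csz_pair.
have h : size (take i (l x)) <= q (csz x).
  apply: leq_trans (leq_trans (size_le_csz (l x)) (hs x)).
  by rewrite size_take; case: ltnP => // /ltnW.
have h1 := csz_nat_le (size (take i (l x))).
have h2 : csz (rev (iota 0 (size (take i (l x))))) <= q (csz x) * (6 * q (csz x) + 1).+1 + 1.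
  apply: leq_trans (csz_all (m := 6 * q (csz x) + 1) _) _.
    apply/allP => a; rewrite mem_rev mem_iota => /andP[_ ha].
    by apply: leq_trans (csz_nat_le a) _; lia.
  by rewrite size_rev size_iota leq_add2r leq_mul2r h orbT.
by lia.
Qed.

(** * Edge order, interchangeable selections and pruning *)

Definition inc (v : nat) (it : item) := (it.1.1 == v) || (it.1.2 == v).
Definition degree (s : seq item) v := count (inc v) s.
Definition colors (s : seq item) k := count (fun it : item => it.2 == k) s.

Definition adjacent (its : seq item) u w := has (fun it => inc u it && inc w it) its.

(* The order of the visits is that of a depth-first search: the next vertex is
   attached to the last visited vertex that still has an unvisited neighbour. *)
Definition next_vertex (its : seq item) (V vs : seq nat) : nat :=
  head 0 (flatten [seq [seq w <- V | (w \notin vs) && adjacent its u w] | u <- vs]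
          ++ [seq w <- V | w \notin vs]).

Definition visit (its : seq item) (V : seq nat) (st : seq nat * seq item) :=
  let w := next_vertex its V st.1 in
  (w :: st.1,
   st.2 ++ [seq it : item <- its |
     inc w it && ((it.1.1 \in w :: st.1) && (it.1.2 \in w :: st.1))]).

Definition search (its : seq item) (V : seq nat) :=
  foldl (fun st _ => visit its V st) ([::], [::]) V.

(** [R] holds the edges to come. Degrees are compared at all their endpoints, so the algorithm need
    not know which of these also meet a processed edge: at the others both degrees are 0. *)
Definition same_key (its R s t : seq item) :=
  all (fun it : item => (degree s it.1.1 == degree t it.1.1)
    && (degree s it.1.2 == degree t it.1.2)) R
  && all (fun it : item => colors s it.2 == colors t it.2) its.

(** Programs compute with natural numbers only, so the objective is kept as a difference of two
    sums, and differences are compared by adding crosswise. *)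
Definition valp (z : value) := if z.1 == 0 then z.2.1 else 0.
Definition valn (z : value) := if z.1 == 0 then 0 else z.2.1.

Definition lookup (s : seq item) (vf : nat * seq value) : value :=
  head (0, (0, tt)) (foldr (fun it cur => if inc vf.1 it then behead cur else cur) vf.2 s).

Definition obj_pos (fV : seq (nat * seq value)) s :=
  foldr (fun vf a => valp (lookup s vf) + a) 0 fV.
Definition obj_neg (fV : seq (nat * seq value)) s :=
  foldr (fun vf a => valn (lookup s vf) + a) 0 fV.

Definition obj_le fV s t := obj_pos fV s + obj_neg fV t <= obj_pos fV t + obj_neg fV s.

Definition insert (its : seq item) fV R (acc : seq (seq item)) (s : seq item) :=
  if has (fun t => same_key its R s t && obj_le fV s t) acc then acc
  else s :: [seq t <- acc | ~~ same_key its R s t].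

Definition prune its fV R (S : seq (seq item)) := foldl (insert its fV R) [::] S.

Definition extend its fV (st : seq item * seq (seq item)) (it : item) :=
  (behead st.1, prune its fV (behead st.1) (st.2 ++ map (cons it) st.2)).

Lemma csz_filter A {cA : coded A} (p : pred A) (l : seq A) : csz (filter p l) <= csz l.
Proof. by elim: l => //= a l IH; case: ifP => _; rewrite !csz_cons; lia. Qed.

Lemma next_mem its V vs : next_vertex its V vs = 0 \/ next_vertex its V vs \in V.
Proof.
rewrite /next_vertex; set l := _ ++ _.
have hl : {subset l <= V}.
  move=> w; rewrite mem_cat mem_filter => /orP[|/andP[] //].
  by case/flattenP => s /mapP[u _ ->]; rewrite mem_filter => /andP[].
by case: l hl => [|w l] hl; [left|right; apply: hl; rewrite inE eqxx].
Qed.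

(** * Polynomial time of the single steps *)

Section Steps.
Context X (cX : coded X).

Lemma pt_degree (s : X -> seq item) v :
  ptime s -> ptime v -> ptime (fun x => degree (s x) (v x)).
Proof. by move=> hs hv; rewrite /degree /inc; pt. Qed.

Lemma pt_colors (s : X -> seq item) k :
  ptime s -> ptime k -> ptime (fun x => colors (s x) (k x)).
Proof. by move=> hs hv; rewrite /colors; pt. Qed.

Lemma pt_search its V : ptime its -> ptime V ->
  ptime (fun x : X => search (its x) (V x)).
Proof.
move=> h1 h2.
apply: (pt_comp (g := fun x => (its x, V x)) (f := fun y => search y.1 y.2)); last by pt.
apply: (@pt_foldl _ _ _ _ _ _ (fun y st _ => visit y.1 y.2 st) (fun=> ([::], [::])) _
  (fun n => 2 * n + 10)) => //.
- by rewrite /visit /next_vertex /adjacent /inc; pt.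
- by pt.
- by pt.
- by solve_poly.
- move=> [l U] [vs o] a; rewrite /visit /=; set w := next_vertex _ _ _.
  have hw : csz w <= csz U + 1.
    have [e|h] := next_mem l U vs; first by rewrite /w e leq_addl.
    exact: leq_trans (csz_mem h) (leq_addr _ _).
  set g := filter _ _; have hg : csz g <= csz l by apply: csz_filter.
  have hc : csz (o ++ g) <= csz o + csz g by apply: csz_cat.
  by rewrite (csz_pair (w :: vs)) (csz_pair vs) (csz_pair l) csz_cons; lia.
Qed.
End Steps.

Section Keys.
Context X (cX : coded X).
Implicit Types (s t : X -> seq item).

Ltac pt_more ::=
  lazymatch goal with
  | |- ptime (fun x => degree _ _) => apply: pt_degree; pt
  | |- ptime (fun x => colors _ _) => apply: pt_colors; pt
  | |- _ => pt_list
  end.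

Lemma pt_same_key its R s t : ptime its -> ptime R -> ptime s -> ptime t ->
  ptime (fun x => same_key (its x) (R x) (s x) (t x)).
Proof. by move=> h1 h2 h3 h4; rewrite /same_key; pt. Qed.

Lemma pt_lookup s vf : ptime s -> ptime vf -> ptime (fun x => lookup (s x) (vf x)).
Proof.
move=> h1 h2; rewrite /lookup; apply: pt_head.
apply: (@pt_foldr _ _ _ _ _ _
  (fun x it (cur : seq value) => if inc (vf x).1 it then behead cur else cur) _ _
  (fun n => n)) => //.
- by rewrite /inc; pt.
- by pt.
- by solve_poly.
- move=> x c a; case: ifP => _; rewrite ?leq_addr //.
  exact: leq_trans (csz_behead c) (leq_addr _ _).
Qed.
End Keys.

Section Objective.
Context X (cX : coded X).
Implicit Types (s t : X -> seq item).

Ltac pt_more ::=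
  lazymatch goal with
  | |- ptime (fun x => lookup _ _) => apply: pt_lookup; pt
  | |- _ => pt_list
  end.

Lemma pt_obj_pos fV s : ptime fV -> ptime s -> ptime (fun x => obj_pos (fV x) (s x)).
Proof.
move=> h1 h2.
apply: (@pt_sum _ _ _ _ (fun x vf => valp (lookup (s x) vf)) fV) => //.
by rewrite /valp; pt.
Qed.

Lemma pt_obj_neg fV s : ptime fV -> ptime s -> ptime (fun x => obj_neg (fV x) (s x)).
Proof.
move=> h1 h2.
apply: (@pt_sum _ _ _ _ (fun x vf => valn (lookup (s x) vf)) fV) => //.
by rewrite /valn; pt.
Qed.

Lemma pt_obj_le fV s t : ptime fV -> ptime s -> ptime t ->
  ptime (fun x => obj_le (fV x) (s x) (t x)).
Proof.
by move=> h1 h2 h3; rewrite /obj_le; apply: pt_leq; apply: pt_addn;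
  first [exact: pt_obj_pos | exact: pt_obj_neg].
Qed.
End Objective.

Section Extension.
Context X (cX : coded X).

Ltac pt_more ::=
  lazymatch goal with
  | |- ptime (fun x => same_key _ _ _ _) => apply: pt_same_key; pt
  | |- ptime (fun x => obj_le _ _ _) => apply: pt_obj_le; pt
  | |- _ => pt_list
  end.

Lemma pt_prune its fV R S : ptime its -> ptime fV -> ptime R -> ptime S ->
  ptime (fun x : X => prune (its x) (fV x) (R x) (S x)).
Proof.
move=> h1 h2 h3 h4; rewrite /prune.
apply: (@pt_foldl _ _ _ _ _ _ (fun x => insert (its x) (fV x) (R x)) (fun=> [::]) _
  (fun n => n + 1)) => //.
- by rewrite /insert; pt.
- by pt.
- by solve_poly.
- move=> x acc a; rewrite /insert; case: ifP => _; first by rewrite leq_addr.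
  rewrite csz_cons; set g := filter _ _; have hg : csz g <= csz acc by apply: csz_filter.
  by lia.
Qed.

Lemma pt_extend its fV st it : ptime its -> ptime fV -> ptime st -> ptime it ->
  ptime (fun x : X => extend (its x) (fV x) (st x) (it x)).
Proof.
move=> h1 h2 h3 h4; rewrite /extend; apply: pt_pair; first by pt.
by apply: pt_prune; pt.
Qed.
End Extension.

(** * Depth-first search and tree-depth *)

Section RootPaths.
Variables (par : nat -> option nat) (d : nat).

Definition shallow v := iter d (obind par) (Some v) = None.

Fixpoint root_path f v : seq nat :=
  if f is f'.+1 then
    if par v is Some u then rcons (root_path f' u) v else [:: v]
  else [::].

Lemma iter_None k : iter k (obind par) None = None.
Proof. by elim: k => //= k ->. Qed.

Lemma root_path_fuel f g v : iter f (obind par) (Some v) = None -> f <= g ->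
  root_path g v = root_path f v.
Proof.
elim: f g v => [//|f IH] [|g] v //; rewrite iterSr /= ltnS.
by case: (par v) => // u h hg; rewrite (IH g).
Qed.

Lemma shallow_par v u : shallow v -> par v = Some u -> shallow u.
Proof.
rewrite /shallow => h e; have -> : Some u = iter 1 (obind par) (Some v) by rewrite /= e.
by rewrite -iterD addn1 /= h.
Qed.

Lemma root_path_par v u : shallow v -> par v = Some u ->
  root_path d v = rcons (root_path d u) v.
Proof.
rewrite /shallow => h e; case: d h => // f; rewrite iterSr => h.
rewrite (@root_path_fuel f f.+1 u) //= ?e //.
by move: h; rewrite /= e.
Qed.

Lemma size_root_path f v : size (root_path f v) <= f.
Proof.
by elim: f v => //= f IH v; case: (par v) => // u; rewrite size_rcons ltnS.
Qed.

Lemma last_root_path v : shallow v -> exists s, root_path d v = rcons s v.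
Proof.
rewrite /shallow; case: d => // f _ /=.
by case: (par v) => [u|]; [exists (root_path f u)|exists [::]].
Qed.

Lemma anc_prefix u v : shallow v -> anc par u v -> prefix (root_path d u) (root_path d v).
Proof.
move=> hv [k]; elim: k v hv => [|k IH] v hv; first by case=> ->; apply: prefix_refl.
rewrite iterSr /=; case E : (par v) => [w|]; last by rewrite iter_None.
move=> /(IH _ (shallow_par hv E)) h; rewrite (root_path_par hv E).
exact: prefix_trans h (prefix_rcons _ _).
Qed.

Variable e : rel nat.
Hypothesis e_anc : forall u v, e u v -> anc par u v \/ anc par v u.

(** Of two adjacent vertices one is an ancestor of the other, so one root path is a prefix of the
    other and both have the same entry at position [k]; this propagates along [Q]. *)
Lemma sorted_root Q k : sorted e Q ->
  (forall v, v \in Q -> shallow v /\ k < size (root_path d v)) ->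
  {in Q &, forall u v, nth 0 (root_path d u) k = nth 0 (root_path d v) k}.
Proof.
case: Q => // x p hp hQ.
suff h : {in x :: p, forall v, nth 0 (root_path d v) k = nth 0 (root_path d x) k}.
  by move=> u v /h -> /h ->.
elim: p x hp hQ => [|y p IH] x; first by move=> _ _ v; rewrite inE => /eqP ->.
move=> /= /andP[exy hp] hQ v; rewrite inE => /orP[/eqP ->//|hv].
rewrite (IH y) //; last by move=> w hw; apply: hQ; rewrite inE hw orbT.
have [sx kx] := hQ x (mem_head _ _).
have [|sy ky] := hQ y; first by rewrite !inE eqxx orbT.
have pn s t : prefix s t -> k < size s -> nth 0 s k = nth 0 t k.
  by move=> /prefixP[u ->] hk; rewrite nth_cat hk.
by case: (e_anc exy) => [/(anc_prefix sy)|/(anc_prefix sx)] /pn ->.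
Qed.

(* Along a path all of whose vertices have depth greater than [k], the ancestor
   of depth [k+1] is constant, so at most one vertex has depth exactly [k+1]:
   splitting there doubles the bound at each level. *)
Lemma path_bound Q m : uniq Q -> sorted e Q ->
  (forall v, v \in Q -> shallow v /\ d - m < size (root_path d v)) -> m <= d ->
  size Q < 2 ^ m.
Proof.
elim: m Q => [|m IH] Q uQ sQ hQ hm.
  case: Q {uQ sQ} hQ => // x p /(_ x (mem_head _ _))[_].
  by rewrite subn0 ltnNge size_root_path.
have IH' Q' : uniq Q' -> sorted e Q' -> {subset Q' <= Q} ->
    (forall v, v \in Q' -> size (root_path d v) != (d - m.+1).+1) -> size Q' < 2 ^ m.
  move=> u' s' sub h'; apply: IH => // [v hv|]; last exact: ltnW.
  by have [? ?] := hQ _ (sub _ hv); split=> //; have := h' _ hv; lia.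
have hE : 2 ^ m.+1 = 2 ^ m + 2 ^ m by rewrite expnS mul2n addnn.
case: (boolP (has (fun v => size (root_path d v) == (d - m.+1).+1) Q)); last first.
  move/hasPn => h; have := IH' Q uQ sQ (fun v hv => hv) h; lia.
case/hasP => v vQ /eqP hv.
(* A vertex of this depth is the last entry of its own root path, at the position where all vertices
   of [Q] share one entry. *)
have same u : u \in Q -> size (root_path d u) = (d - m.+1).+1 -> u = v.
  move=> uQ' hu; have := sorted_root sQ hQ uQ' vQ.
  have [s es] := last_root_path (hQ _ uQ').1; have [t et] := last_root_path (hQ _ vQ).1.
  move: hu hv; rewrite es et !size_rcons => -[hs] [ht].
  by rewrite !nth_rcons -hs ltnn eqxx hs -ht ltnn eqxx.
case/splitPr: vQ uQ sQ hQ IH' same => Q1 Q2 uQ sQ hQ IH' same.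
have [s1 s2] : sorted e Q1 /\ sorted e Q2.
  move: sQ; rewrite -cat_rcons => /cat_sorted2[s1 s2].
  by split=> //; move: s1; rewrite -cats1 => /cat_sorted2[].
move: uQ; rewrite cat_uniq /= negb_or => /and4P[u1 /andP[v1 _] v2 u2].
have h1 : size Q1 < 2 ^ m.
  apply: IH' => // [u hu|u hu]; first by rewrite mem_cat hu.
  by apply/eqP => /same hs; move: v1; rewrite -hs ?hu // mem_cat hu.
have h2 : size Q2 < 2 ^ m.
  apply: IH' => // [u hu|u hu]; first by rewrite mem_cat inE hu !orbT.
  by apply/eqP => /same hs; move: v2; rewrite -hs ?hu // mem_cat inE hu !orbT.
by rewrite size_cat /= hE; apply: leq_add h1 h2.
Qed.

End RootPaths.

(** * Invariants of the depth-first search *)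

Section Search.
Variables (its : seq item) (V : seq nat).

(** [adjacent its u u] holds as soon as [u] meets an edge, so equality is excluded separately. *)
Definition edge u w := adjacent its u w && (u != w).
Definition is_open (vs : seq nat) u := has (fun w => (w \notin vs) && adjacent its u w) V.

Lemma adjacent_sym u w : adjacent its u w = adjacent its w u.
Proof. by apply: eq_has => it; rewrite andbC. Qed.

Lemma head_filter_cat (p : pred nat) s t :
  head 0 (filter p s ++ t) = if has p s then head 0 (filter p s) else head 0 t.
Proof.
by elim: s => //= x s IH; case: (p x).
Qed.

Lemma head_filterP (p : pred nat) s : has p s ->
  head 0 (filter p s) \in s /\ p (head 0 (filter p s)).
Proof.
elim: s => //= x s IH; case: ifP => /= [px _|_ /IH[h1 h2]]; rewrite !inE ?eqxx //.
by rewrite h1 orbT.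
Qed.

Lemma next_vertexP (vs : seq nat) : has (fun w => w \notin vs) V ->
  let w := next_vertex its V vs in
  [/\ w \in V, w \notin vs
    & (forall u, u \in vs -> ~~ is_open vs u) \/
      exists vs1 u vs2, [/\ vs = vs1 ++ u :: vs2, is_open vs u, adjacent its u w
        & forall v, v \in vs1 -> ~~ is_open vs v]].
Proof.
move=> hV; rewrite /next_vertex; set F := filter (fun w => w \notin vs) V.
(* The scanned list is generalised to [us] while the visited set inside the filter remains [vs]. *)
suff h us : let w := head 0 (flatten
      [seq [seq w <- V | (w \notin vs) && adjacent its u w] | u <- us] ++ F) in
  [/\ w \in V, w \notin vs
    & (forall u, u \in us -> ~~ is_open vs u) \/
      exists vs1 u vs2, [/\ us = vs1 ++ u :: vs2, is_open vs u, adjacent its u w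
        & forall v, v \in vs1 -> ~~ is_open vs v]] by apply: h.
elim: us => [|u us IH].
  by have [? ?] := head_filterP hV; split=> //; left.
rewrite [map _ _]/= [flatten _]/= -catA head_filter_cat; case: ifPn => hu w.
  have [h1 /andP[h2 h3]] := head_filterP hu; split=> //; right.
  by exists [::], u, us; split.
have [h1 h2 h3] := IH; split=> //; case: h3 => [h3|[vs1 [v [vs2 [e h3 h4 h5]]]]].
  by left=> v; rewrite inE => /orP[/eqP ->|/h3].
right; exists (u :: vs1), v, vs2; split=> //; first by rewrite e.
by move=> x; rewrite inE => /orP[/eqP ->|/h5].
Qed.

(** [P] plays the role of the current branch of the search. Being a subsequence of the visiting
    order, latest first, it can be cut at a given vertex. *)
Definition covered (vs : seq nat) :=
  exists P, [/\ subseq P vs, sorted edge P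
    & forall u, u \in vs -> is_open vs u -> u \in P].

(** The new vertex [w] is adjacent to the latest open vertex [u]. Vertices visited after [u] have no
    unvisited neighbour, so they may be deleted from [P], and [w] followed by the rest from [u] on
    is again a path. If no vertex is open, [w] starts a new branch. *)
Lemma covered_next (vs : seq nat) : uniq vs -> has (fun w => w \notin vs) V -> covered vs ->
  covered (next_vertex its V vs :: vs).
Proof.
move=> uvs hV [P [sP eP oP]]; have [_ wvs hw] := next_vertexP hV.
set w := next_vertex its V vs in wvs hw *.
have mono u : is_open (w :: vs) u -> is_open vs u.
  case/hasP => x xV /andP[]; rewrite inE negb_or => /andP[_ h1] h2.
  by apply/hasP; exists x; rewrite ?h1.
case: hw => [hno|[vs1 [u [vs2 [e hu auw h1]]]]].
  exists [:: w]; split=> //=; first by rewrite eqxx sub0seq.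
  by move=> u; rewrite inE => /orP[/eqP ->|/hno h /mono]; rewrite ?mem_head ?(negPf h).
have uP : u \in P by apply: oP => //; rewrite e mem_cat mem_head orbT.
have eqP' : P = filter (mem P) vs1 ++ u :: filter (mem P) vs2.
  by rewrite {1}(elimT (subseq_uniqP uvs) sP) e filter_cat /= uP.
exists [:: w, u & filter (mem P) vs2]; split.
- rewrite /= eqxx e; apply: subseq_trans (suffix_subseq _ _).
  by rewrite /= eqxx filter_subseq.
- apply/andP; split; last by move: eP; rewrite {1}eqP' => /cat_sorted2[].
  rewrite /edge adjacent_sym auw /=.
  by apply: contra wvs => /eqP ->; rewrite e mem_cat mem_head orbT.
- move=> x; rewrite inE => /orP[/eqP ->|xvs /mono ox]; first by rewrite mem_head.
  have := oP x xvs ox; rewrite {1}eqP' mem_cat => /orP[|h]; last by rewrite inE h orbT.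
  by rewrite mem_filter => /andP[_ /h1]; rewrite ox.
Qed.

Definition touched (Q : seq item) v := has (inc v) Q.

(** The unprocessed edge ranges over all of [its], not only over [out], so that the property can be
    maintained while the search is still running. *)
Definition narrow K (out : seq item) := forall Q R, out = Q ++ R ->
  exists2 A, size A <= K &
    forall v, touched Q v -> (exists it, [/\ it \in its, it \notin Q & inc v it]) -> v \in A.

Variable K : nat.
Hypothesis path_small : forall P, uniq P -> {subset P <= V} -> sorted edge P -> size P < K.
Hypothesis its_uniq : uniq its.
Hypothesis its_V : forall it, it \in its -> it.1.1 \in V /\ it.1.2 \in V.

Definition search_inv (st : seq nat * seq item) :=
  [/\ uniq st.1, {subset st.1 <= V}, covered st.1
    & [/\ uniq st.2, narrow K st.2
      & forall it, (it \in st.2) = [&& it \in its, it.1.1 \in st.1 & it.1.2 \in st.1]]].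

Lemma search_inv0 : search_inv ([::], [::]).
Proof.
split=> //; first by exists [::].
split=> //; first by case=> // R _; exists [::].
by move=> it; rewrite !andbF.
Qed.

(** A prefix ending inside the old edges is handled by the invariant. Otherwise it contains all
    edges between old vertices, so a missing edge at a vertex [v] other than [w] leads to a vertex
    not visited before [w]; thus [v] was open and lies on the path. *)
Lemma visit_inv st : search_inv st -> has (fun w => w \notin st.1) V ->
  search_inv (visit its V st) /\ size (visit its V st).1 = (size st.1).+1.
Proof.
case: st => vs out [/= uvs subV cov [uout nar mem_out]] hV; split=> //.
have [wV wvs _] := next_vertexP hV; have cov' := covered_next uvs hV cov.
rewrite /visit /=; set w := next_vertex its V vs in wV wvs cov' *; set G := filter _ its.
have memG it : (it \in G) = [&& inc w it, it.1.1 \in w :: vs, it.1.2 \in w :: vs & it \in its].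
  by rewrite mem_filter -!andbA.
have inc_vs it v : inc v it -> v \in vs -> it \in its -> it \notin out ->
    exists2 x, x \notin vs & inc x it.
  move=> iv vvs hit; rewrite mem_out hit /=.
  case/nandP => h; [exists it.1.1|exists it.1.2] => //; by rewrite /inc eqxx ?orbT.
split=> /=.
- by rewrite wvs.
- by move=> x; rewrite inE => /orP[/eqP ->|/subV].
- exact: cov'.
split.
- rewrite cat_uniq uout filter_uniq // andbT /=; apply/hasPn => it.
  rewrite memG mem_out => /and4P[/orP[/eqP e|/eqP e] _ _ _]; rewrite e (negPf wvs) ?andbF //.
- move=> Q R eQR; case: (leqP (size Q) (size out)) => hQ.
    have eQ : out = Q ++ take (size out - size Q) R.
      have := congr1 (take (size out)) eQR.
      by rewrite take_size_cat // take_cat ltnNge hQ.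
    have [A hA hA'] := nar _ _ eQ; exists A => //.
  have [Q1 [eQ sub1]] : exists Q1, Q = out ++ Q1 /\ {subset Q1 <= G}.
    have e1 : Q = out ++ take (size Q - size out) G.
      have := congr1 (take (size Q)) eQR.
      by rewrite take_cat ltnNge (ltnW hQ) /= take_size_cat // => <-.
    by eexists; split; [exact: e1|move=> it /mem_take].
  have [P [sP eP oP]] := cov.
  (* [P] is the path from before the visit of [w]; the strict bound [size P < K] leaves room for
     [w]. *)
  exists (w :: P).
    by apply: path_small eP; [exact: subseq_uniq sP uvs | move=> x /(mem_subseq sP) /subV].
  move=> v tv [it [hit nit iv]]; rewrite inE; case: eqP => //= /eqP vw.
  have vvs : v \in vs.
    suff : v \in w :: vs by rewrite inE (negPf vw).
    case/hasP: tv => j; rewrite eQ mem_cat => /orP[|/sub1].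
      rewrite mem_out => /and3P[_ h1 h2] /orP[] /eqP <-; by rewrite inE ?h1 ?h2 orbT.
    by rewrite memG => /and4P[_ h1 h2 _] /orP[] /eqP <-.
  apply: oP => //; have [|x xvs ix] := inc_vs it v iv vvs hit.
    by apply: contra nit => h; rewrite eQ mem_cat h.
  apply/hasP; exists x; last by rewrite xvs /=; apply/hasP; exists it; rewrite ?iv.
  by have [h1 h2] := its_V hit; case/orP: ix => /eqP <-.
- move=> it; rewrite mem_cat mem_out memG !inE /inc.
  case: (it \in its) => //=; rewrite ?andbF ?andbT //=.
  have [->|n1] := eqVneq it.1.1 w; have [->|n2] := eqVneq it.1.2 w => //=;
    by rewrite ?(negPf wvs) ?andbF ?orbF ?orbT ?andbT //=.
Qed.

(** Each round visits exactly one new vertex, so after [size V] rounds every edge has both endpoints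
    visited. *)
Lemma searchP : uniq V ->
  let ord := (search its V).2 in [/\ uniq ord, ord =i its & narrow K ord].
Proof.
move=> uV.
have h i : i <= size V -> let st := foldl (fun st _ => visit its V st) ([::], [::]) (take i V) in
    search_inv st /\ size st.1 = i.
  elim: i => [|i IH] hi; first by rewrite take0; split=> //; exact: search_inv0.
  rewrite (take_nth 0) // foldl_rcons; have [inv sz_i] := IH (ltnW hi).
  set st := foldl _ _ _ in inv sz_i *.
  have hV : has (fun w => w \notin st.1) V.
    rewrite -[has _ _]negbK -all_predC; apply/negP => /allP h.
    have : size V <= size st.1.
      by apply: uniq_leq_size => // x /h /=; rewrite negbK.
    by rewrite sz_i leqNgt hi.
  by have [h1 h2] := visit_inv inv hV; split; [exact: h1|rewrite -sz_i; exact: h2].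
have [] := h _ (leqnn _); rewrite take_size -/(search its V).
case=> [u1 sub _ [u2 nar mem_ord]] e; split=> // it.
have [_ hV] := uniq_min_size u1 sub (eq_leq (esym e)).
rewrite mem_ord; case: (boolP (it \in its)) => //= hit.
by have [h1 h2] := its_V hit; rewrite !hV h1 h2.
Qed.

End Search.

(** * Dominance between selections *)

Lemma degree_cons it s v : degree (it :: s) v = inc v it + degree s v.
Proof. by []. Qed.

Lemma lookupE s vf : lookup s vf = nth (0, (0, tt)) vf.2 (degree s vf.1).
Proof.
rewrite /lookup.
have -> : foldr (fun it cur => if inc vf.1 it then behead cur else cur) vf.2 s
    = drop (degree s vf.1) vf.2.
  elim: s => [|it s IH]; first by rewrite drop0.
  rewrite [foldr _ _ _]/= IH degree_cons; case: (inc _ _) => //.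
  by rewrite -drop1 drop_drop add1n.
by rewrite -nth0 nth_drop addn0.
Qed.

Section Dynamic.
Variables (its : seq item) (fV : seq (nat * seq value)).
Notation same R s t := (same_key its R s t).
Notation le s t := (obj_le fV s t).

Lemma same_keyP R s t : reflect
  ((forall it, it \in R -> degree s it.1.1 = degree t it.1.1 /\ degree s it.1.2 = degree t it.1.2)
   /\ forall it, it \in its -> colors s it.2 = colors t it.2) (same R s t).
Proof.
apply: (iffP andP) => [[/allP h1 /allP h2]|[h1 h2]]; split.
- by move=> it /h1 /andP[/eqP ? /eqP].
- by move=> it /h2 /eqP.
- by apply/allP => it /h1[-> ->]; rewrite !eqxx.
- by apply/allP => it /h2 ->.
Qed.

Lemma same_key_refl R s : same R s s. Proof. exact/same_keyP. Qed.

Lemma same_key_sym R s t : same R s t = same R t s.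
Proof.
suff h u v : same R u v -> same R v u by apply/idP/idP; apply: h.
move=> /same_keyP[h1 h2]; apply/same_keyP.
by split=> it hit; [have [-> ->] := h1 _ hit | rewrite h2].
Qed.

Lemma same_key_trans R s t u : same R s t -> same R t u -> same R s u.
Proof.
move=> /same_keyP[h1 h2] /same_keyP[h3 h4]; apply/same_keyP; split=> it hit.
  by have [-> ->] := h1 _ hit; apply: h3.
by rewrite h2 // h4.
Qed.

Lemma obj_le_refl s : le s s. Proof. exact: leqnn. Qed.

Lemma obj_le_trans s t u : le s t -> le t u -> le s u.
Proof. by rewrite /obj_le; lia. Qed.

Definition dominated R (S : seq (seq item)) s := has (fun t => same R s t && le s t) S.

Lemma dominatedP R S s :
  reflect (exists t, [/\ t \in S, same R s t & le s t]) (dominated R S s).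
Proof.
apply: (iffP hasP) => [[t tS /andP[? ?]]|[t [tS h1 h2]]]; exists t => //.
by rewrite h1.
Qed.

Lemma insert_dominated R S s t :
  (t == s) || dominated R S t -> dominated R (insert its fV R S s) t.
Proof.
rewrite /insert; case: ifPn => hs.
  by case/orP => [/eqP ->|//]; exact: hs.
case/orP => [/eqP ->|/dominatedP[u [uS h1 h2]]].
  by apply/dominatedP; exists s; rewrite mem_head same_key_refl obj_le_refl.
have [hsu|hsu] := boolP (same R s u); last first.
  by apply/dominatedP; exists u; rewrite inE mem_filter hsu uS orbT.
apply/dominatedP; exists s; rewrite mem_head; split=> //.
  by apply: same_key_trans h1 _; rewrite same_key_sym.
apply: obj_le_trans h2 _; move/hasPn: hs => /(_ u uS); rewrite hsu /=.
by rewrite /obj_le; lia.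
Qed.

Lemma prune_spec R S : let T := prune its fV R S in
  [/\ {subset T <= S}, pairwise (fun s t => ~~ same R s t) T
    & forall s, s \in S -> dominated R T s].
Proof.
rewrite /prune; elim/last_ind: S => [|S s [h1 h2 h3]]; first by split.
rewrite foldl_rcons; set T := foldl _ _ _ in h1 h2 h3 *.
split.
- move=> t; rewrite mem_rcons inE /insert; case: ifP => _.
    by move/h1 ->; rewrite orbT.
  by rewrite inE mem_filter => /orP[->//|/andP[_ /h1 ->]]; rewrite orbT.
- rewrite /insert; case: ifP => // _; rewrite pairwise_cons pairwise_filter // andbT.
  by apply/allP => t; rewrite mem_filter => /andP[].
- move=> t; rewrite mem_rcons inE => /orP[/eqP ->|/h3 ht].
    by apply: insert_dominated; rewrite eqxx.
  by apply: insert_dominated; rewrite ht orbT.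
Qed.

Lemma lookup_degree s t vf : degree s vf.1 = degree t vf.1 -> lookup s vf = lookup t vf.
Proof. by move=> e; rewrite !lookupE e. Qed.

(** At each vertex, either the new edge misses it and the summands of both selections stay
    unchanged, or it is an endpoint and the two summands agree before and after. So both objectives
    change by the same amount. *)
Lemma obj_le_cons it s t :
  degree s it.1.1 = degree t it.1.1 -> degree s it.1.2 = degree t it.1.2 ->
  le s t -> le (it :: s) (it :: t).
Proof.
move=> h1 h2.
have h vf : lookup (it :: s) vf = lookup s vf /\ lookup (it :: t) vf = lookup t vf \/
    lookup s vf = lookup t vf /\ lookup (it :: s) vf = lookup (it :: t) vf.
  case E : (inc vf.1 it).
    have hd : degree s vf.1 = degree t vf.1 by case/orP: E => /eqP <-.
    by right; split; apply: lookup_degree; rewrite ?degree_cons hd.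
  by left; split; apply: lookup_degree; rewrite degree_cons E.
have hp : obj_pos fV (it :: s) + obj_pos fV t = obj_pos fV (it :: t) + obj_pos fV s.
  rewrite /obj_pos; elim: (fV) => // vf l IH; rewrite ![foldr _ _ (_ :: _)]/=.
  by case: (h vf) => -[-> ->]; lia.
have hn : obj_neg fV (it :: s) + obj_neg fV t = obj_neg fV (it :: t) + obj_neg fV s.
  rewrite /obj_neg; elim: (fV) => // vf l IH; rewrite ![foldr _ _ (_ :: _)]/=.
  by case: (h vf) => -[-> ->]; lia.
by rewrite /obj_le; lia.
Qed.

Definition states ord (i : nat) :=
  foldl (extend its fV) (ord, [:: [::]]) (take i ord).

(** For the last conjunct, remove the newest edge from [t] if it is there, take a stored selection
    dominating the rest, put the edge back into both, and pass to the coarser key of the shorter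
    list of remaining edges. Edges are consed, hence the reversed order. *)
Lemma statesP ord i : i <= size ord ->
  let st := states ord i in
  [/\ st.1 = drop i ord, {in st.2, forall s, subseq s (rev (take i ord))},
      pairwise (fun s t => ~~ same (drop i ord) s t) st.2
    & forall t, subseq t (rev (take i ord)) -> dominated (drop i ord) st.2 t].
Proof.
rewrite /states; elim: i => [|i IH] hi.
  rewrite take0 drop0; split=> //= [s|t]; first by rewrite inE => /eqP ->.
  by move=> /eqP ->; rewrite same_key_refl obj_le_refl.
have [] := IH (ltnW hi); pose x0 : item := ((0, 0), 0).
rewrite (take_nth x0 hi) foldl_rcons rev_rcons.
set st := foldl _ _ _; case: st => R S /= -> hsub hpw hdom; set it := nth x0 ord i.
have eR : drop i ord = it :: drop i.+1 ord by rewrite -(drop_nth x0).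
rewrite /extend /= eR /=.
have [h1 h2 h3] := prune_spec (drop i.+1 ord) (S ++ map (cons it) S).
split=> //.
- move=> s /h1; rewrite mem_cat => /orP[/hsub h|/mapP[t /hsub h ->]].
    exact: subseq_trans h (subseq_cons _ _).
  by rewrite /= eqxx.
- move=> t ht.
  have weak s u : same (drop i ord) s u -> same (drop i.+1 ord) s u.
    move=> /same_keyP[g1 g2]; apply/same_keyP; split=> // j hj.
    by apply: g1; rewrite eR inE hj orbT.
  have [u [b [et hu]]] : exists u b, t = (if b then it :: u else u) /\
      subseq u (rev (take i ord)).
    case: t ht => [|x t]; first by exists [::], false; rewrite sub0seq.
    by rewrite /=; case: eqP => [->|_] ht; [exists t, true|exists (x :: t), false].
  have /dominatedP[s [sS g1 g2]] := hdom _ hu.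
  have hw : same (drop i.+1 ord) t (if b then it :: s else s) /\
      le t (if b then it :: s else s).
    rewrite et; case: b {et}; last by split=> //; apply: weak.
    have /same_keyP[k1 k2] := g1.
    have [|d1 d2] := k1 it; first by rewrite eR mem_head.
    split; last exact: obj_le_cons.
    have /same_keyP[w1 _] := weak _ _ g1.
    apply/same_keyP; split=> j hj; first by have [c1 c2] := w1 j hj; rewrite !degree_cons c1 c2.
    by rewrite /colors /= -!/(colors _ _) k2.
  have /h3/dominatedP[v [vT v1 v2]] : (if b then it :: s else s) \in S ++ map (cons it) S.
    by rewrite mem_cat; case: (b); rewrite ?map_f ?sS ?orbT.
  apply/dominatedP; exists v; split=> //.
    by apply: same_key_trans v1; case: hw.
  by apply: obj_le_trans v2; case: hw.
Qed.

Variables (p K : nat) (ord : seq item).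
Hypothesis its_p : forall it, it \in its -> it.2 < p.
Hypothesis ord_uniq : uniq ord.
Hypothesis ord_its : ord =i its.
Hypothesis ord_narrow : narrow its K ord.

(** Stored selections have pairwise different keys, so recording the degrees on [A] and the colour
    counts is injective; this gives [K + p] numbers, each at most [size ord]. *)
Lemma size_states i : i <= size ord -> size (states ord i).2 <= (size ord).+1 ^ (K + p).
Proof.
move=> hi; have [_ hsub hpw _] := statesP hi; set S := (states ord i).2 in hsub hpw *.
have [A hA hact] := ord_narrow (esym (cat_take_drop i ord)).
have small s : s \in S -> size s <= size ord.
  move=> /hsub/size_subseq h; apply: leq_trans h _.
  by rewrite size_rev size_take; case: ltnP => // /ltnW.
(* Positions beyond [size A] read the default vertex 0; the argument evaluates degree entries only
   at positions [index v A] with [v] in [A]. *)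
pose key s : (K + p).-tuple 'I_(size ord).+1 := [tuple
  inord (if j < K then degree s (nth 0 A j) else colors s (j - K)) | j < K + p].
(* A vertex outside [A] that meets a remaining edge meets no processed one. *)
have degE s v : s \in S -> v \notin A -> forall it, it \in drop i ord -> inc v it -> degree s v = 0.
  move=> /hsub hs vA it hit iv; apply/eqP; rewrite -leqn0 leqNgt -has_count.
  apply: contra vA => /hasP[j js ij]; apply: hact.
    by apply/hasP; exists j => //; have := mem_subseq hs js; rewrite mem_rev.
  exists it; split=> //; first by rewrite -ord_its (mem_drop hit).
  apply/negP => h2; move: ord_uniq; rewrite -(cat_take_drop i ord) cat_uniq.
  by case/and3P => _ /hasPn /(_ _ hit); rewrite h2.
have keyE s t : s \in S -> t \in S -> key s = key t -> same (drop i ord) s t.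
  move=> sS tS e.
  have ej (j : 'I_(K + p)) : (if j < K then degree s (nth 0 A j) else colors s (j - K))
      = (if j < K then degree t (nth 0 A j) else colors t (j - K)).
    have := congr1 (fun u => val (tnth u j)) e; rewrite /= !tnth_mktuple !inordK //.
      by rewrite ltnS; apply: leq_trans (small _ tS); case: ifP => _; apply: count_size.
    by rewrite ltnS; apply: leq_trans (small _ sS); case: ifP => _; apply: count_size.
  have dE v it : it \in drop i ord -> inc v it -> degree s v = degree t v.
    move=> hit iv; have [vA|vA] := boolP (v \in A); last first.
      by rewrite !(degE _ _ _ vA it).
    have hj : index v A < K by apply: leq_trans hA; rewrite index_mem.
    have := ej (Ordinal (ltn_addr p hj)); rewrite /= hj nth_index //.
  apply/same_keyP; split=> it hit.
    by split; apply: (dE _ it) => //; rewrite /inc eqxx ?orbT.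
  have hj : K + it.2 < K + p by rewrite ltn_add2l its_p.
  by have := ej (Ordinal hj); rewrite /= ltnNge leq_addr /= addKn.
have uk T : {subset T <= S} -> pairwise (fun s t => ~~ same (drop i ord) s t) T ->
    uniq (map key T).
  elim: T => // s T IH sub; rewrite pairwise_cons => /andP[/allP hs hT] /=.
  rewrite (IH _ hT) ?andbT; last by move=> t tT; apply: sub; rewrite inE tT orbT.
  apply/mapP => -[t tT e].
  have := hs t tT; rewrite keyE //; first by apply: sub; rewrite mem_head.
  by apply: sub; rewrite inE tT orbT.
have := max_card (mem (map key S)); rewrite (card_uniqP (uk S (fun s h => h) hpw)) size_map.
by rewrite card_tuple card_ord.
Qed.

End Dynamic.

(** * Correctness and running time *)

Definition value_of_int (z : int) : value :=
  match z with Posz k => (0, (k, tt)) | Negz k => (1, (k.+1, tt)) end.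

Definition raw I :=
  (i_n I, ([seq (e.1, (e.2, tt)) | e <- i_E I],
    (i_lab I, (i_m I, ([seq map value_of_int fi | fi <- i_f I], tt))))).

Lemma code_map A B (cB : coded B) (g : A -> data) (h : A -> B) l :
  (forall a, tree_of_data (g a) = code (h a)) ->
  tree_of_data (DList (map g l)) = code (map h l).
Proof.
move=> E /=; rewrite -map_comp; elim: l => // a l IH.
by rewrite /= [tree_of_data _]E; congr Node; exact: IH.
Qed.

Lemma parse_instance I : parse_tree (rev (enc_instance I)) = code (raw I).
Proof.
rewrite /enc_instance parse_enc.
have hE : tree_of_data (DList [seq DList [:: DNat e.1; DNat e.2] | e <- i_E I])
  = code [seq (e.1, (e.2, tt)) | e <- i_E I] by exact: code_map.
have hn l : tree_of_data (DList (map DNat l)) = code l.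
  by rewrite -[in RHS](map_id l); apply: code_map.
have hf : tree_of_data (DList [seq DList (map DInt fi) | fi <- i_f I])
  = code [seq map value_of_int fi | fi <- i_f I].
  by apply: code_map => fi; apply: code_map => -[].
have -> u1 u2 u3 u4 u5 : tree_of_data (DList [:: u1; u2; u3; u4; u5]) =
  Node (tree_of_data u1) (Node (tree_of_data u2) (Node (tree_of_data u3)
    (Node (tree_of_data u4) (Node (tree_of_data u5) Leaf)))) by [].
by rewrite hE !hn hf.
Qed.

Definition edge_items I : seq item := zip (i_E I) (i_lab I).
Definition values I := map (map value_of_int) (i_f I).
Definition vertices I := iota 0 (size (values I)).
Definition priced I := zip (vertices I) (values I).
Definition ordered I := (search (edge_items I) (vertices I)).2.
Definition final I := (states (edge_items I) (priced I) (ordered I) (size (ordered I))).2.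

Definition matching p I :=
  [seq s <- final I | all (fun km : nat * nat => colors s km.1 == km.2)
                        (zip (iota 0 p) (i_m I))].

Definition selection (its s : seq item) :=
  [seq has (fun t : item => (t.1.1 == it.1.1) && (t.1.2 == it.1.2)) s | it <- its].

Definition solution p I :=
  if nilp (matching p I) then None
  else Some (selection (edge_items I) (head [::] (matching p I))).

Lemma nth_value fi k :
  nth (0, (0, tt)) (map value_of_int fi) k = value_of_int (nth 0%R fi k).
Proof. by elim: fi k => [|z l IH] [|k]; rewrite ?nth_nil //=. Qed.

Lemma uniq_map_inj (A B : eqType) (f : A -> B) s :
  uniq (map f s) -> {in s &, injective f}.
Proof.
elim: s => // a s IH /= /andP[ha /IH h] x y; rewrite !inE.
case/orP => [/eqP ->|xs] /orP[/eqP ->|ys] // e; last exact: h.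
  by move: ha; rewrite e map_f.
by move: ha; rewrite -e map_f.
Qed.

Section Correctness.
Variables (p d : nat) (I : instance).
Hypothesis valid : valid_instance p d I.

Lemma size_lab : size (i_lab I) = size (i_E I). Proof. by case: valid => _ []. Qed.

Lemma unzip1_items : map fst (edge_items I) = i_E I.
Proof. by rewrite [LHS]unzip1_zip // size_lab. Qed.

Lemma unzip2_items : map snd (edge_items I) = i_lab I.
Proof. by rewrite [LHS]unzip2_zip // size_lab. Qed.

Lemma edge_items_uniq : uniq (edge_items I).
Proof. by apply: (@map_uniq _ _ fst); rewrite unzip1_items; case: valid => -[]. Qed.

Lemma size_values : size (values I) = i_n I.
Proof. by rewrite size_map; case: valid => _ _ _ []. Qed.

Lemma edge_items_bound it : it \in edge_items I ->
  [/\ it.1 \in i_E I, it.1.1 < i_n I, it.1.2 < i_n I & it.2 < p].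
Proof.
move=> h; have hE : it.1 \in i_E I by rewrite -unzip1_items map_f.
have hl : it.2 \in i_lab I by rewrite -unzip2_items map_f.
case: valid => -[/allP /(_ _ hE) /andP[h1 h2] _] [_ /allP /(_ _ hl) h3] _ _ _.
by split=> //; apply: ltn_trans h1 h2.
Qed.

(** Tree-depth enters here: with [m = d] the depth condition of [path_bound] only asks for non-empty
    root paths, so every path has fewer than [2 ^ d] vertices. *)
Lemma orderedP : [/\ uniq (ordered I), ordered I =i edge_items I
  & narrow (edge_items I) (2 ^ d) (ordered I)].
Proof.
apply: searchP; last exact: iota_uniq.
- move=> P uP sub sP; case: valid => _ _ _ _ [par [_ hv hh]].
  apply: (@path_bound par d (edge (edge_items I))) => //.
    move=> u v /andP[/hasP[it hit /andP[i1 i2]] ne].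
    have [hE _ _ _] := edge_items_bound hit.
    have := hv _ hE; case/orP: i1 ne => /eqP <-; case/orP: i2 => /eqP <-;
      rewrite ?eqxx // => _ [] h; first [by left | by right].
  move=> v /sub; rewrite mem_iota size_values => /andP[_ vn].
  have sv : shallow par d v by apply: hh.
  by split=> //; rewrite subnn; have [s ->] := last_root_path sv; rewrite size_rcons.
- exact: edge_items_uniq.
- move=> it /edge_items_bound[_ h1 h2 _].
  by rewrite !mem_iota size_values !add0n h1 h2.
Qed.

Lemma degree_deg s sel v : perm_eq s (mask sel (edge_items I)) ->
  degree s v = deg (mask sel (i_E I)) v.
Proof.
move=> /permP h; rewrite /degree h /deg -unzip1_items -map_mask count_map.
by apply: eq_count.
Qed.

Lemma colors_lab s sel k : perm_eq s (mask sel (edge_items I)) ->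
  colors s k = count (pred1 k) (mask sel (i_lab I)).
Proof.
move=> /permP h; rewrite /colors h -unzip2_items -map_mask count_map.
by apply: eq_count.
Qed.

Lemma objectiveE s sel : perm_eq s (mask sel (edge_items I)) ->
  objective I sel = (Posz (obj_pos (priced I) s) - Posz (obj_neg (priced I) s))%R.
Proof.
move=> hs.
have -> : obj_pos (priced I) s = \sum_(vf <- priced I) valp (lookup s vf).
  by rewrite unlock.
have -> : obj_neg (priced I) s = \sum_(vf <- priced I) valn (lookup s vf).
  by rewrite unlock.
rewrite !(big_nth (0, [::])) !big_mkord size_zip size_iota minnn.
rewrite !(big_morph Posz PoszD (erefl _)) -GRing.sumrB /objective -size_values.
apply: eq_bigr => i _; rewrite nth_zip ?size_iota // nth_iota // add0n.
rewrite lookupE /= (degree_deg _ hs) (nth_map [::]); last by rewrite -(size_map (map value_of_int)).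
set fi := nth [::] _ _; set k := deg _ _.
have -> : nth (0, (0, tt)) (map value_of_int fi) k = value_of_int (nth 0%R fi k).
  exact: nth_value.
by case: (nth _ _ _) => m; rewrite /valp /valn /= ?GRing.subr0 ?GRing.sub0r.
Qed.

Lemma final_dominates s : subseq s (rev (ordered I)) ->
  dominated (edge_items I) (priced I) [::] (final I) s.
Proof.
have [_ _ _ h] := statesP (edge_items I) (priced I) (leqnn (size (ordered I))).
by move: h; rewrite take_size drop_size => h /h.
Qed.

Lemma final_subseq s : s \in final I -> subseq s (rev (ordered I)).
Proof.
have [_ h _ _] := statesP (edge_items I) (priced I) (leqnn (size (ordered I))).
by move: h; rewrite take_size => h /h.
Qed.

Lemma final_incomparable :
  pairwise (fun s t => ~~ same_key (edge_items I) [::] s t) (final I).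
Proof.
have [_ _ h _] := statesP (edge_items I) (priced I) (leqnn (size (ordered I))).
by move: h; rewrite drop_size.
Qed.

Lemma matchingP s : reflect (s \in final I /\ forall k, k < p -> colors s k = nth 0 (i_m I) k)
  (s \in matching p I).
Proof.
have sm : size (i_m I) = p by case: valid => _ _ [].
rewrite mem_filter; apply: (iffP andP) => [[/allP h hs]|[hs h]]; split=> //.
  move=> k kp; apply/eqP; apply: (h (k, nth 0 (i_m I) k)).
  rewrite -[k in X in X \in _](nth_iota 0 0 kp) ?add0n.
  have := @mem_nth _ (0, 0) (zip (iota 0 p) (i_m I)) k.
  by rewrite size_zip size_iota sm minnn nth_zip ?size_iota ?sm // nth_iota // add0n; apply.
apply/allP => km /(nthP (0, 0))[k]; rewrite size_zip size_iota sm minnn => kp <-.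
by rewrite nth_zip ?size_iota ?sm //= nth_iota // h // add0n.
Qed.

(** The edges of the graph are distinct, so an item is determined by its endpoints and [selection]
    may compare these alone. *)
Lemma selection_perm s : subseq s (rev (ordered I)) ->
  perm_eq s (mask (selection (edge_items I) s) (edge_items I)).
Proof.
have [uo mo _] := orderedP => hs.
have us : uniq s by apply: subseq_uniq hs _; rewrite rev_uniq.
have sub : {subset s <= edge_items I} by move=> it /(mem_subseq hs); rewrite mem_rev mo.
rewrite -filter_mask; apply: uniq_perm => // [|it]; first exact: filter_uniq edge_items_uniq.
rewrite mem_filter; case: (boolP (it \in edge_items I)) => hit; last first.
  by rewrite andbF; apply/negP => /sub; apply/negP.
rewrite andbT; apply/idP/hasP => [h|[t ts /andP[/eqP e1 /eqP e2]]].
  by exists it; rewrite ?eqxx.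
suff -> : it = t by [].
apply: (uniq_map_inj (f := fst) _ hit (sub _ ts)).
  by rewrite unzip1_items; case: valid => -[].
by apply/esym; case: (it.1) (t.1) e1 e2 => [a b] [a' b'] /= -> ->.
Qed.

Definition chosen (sel : seq bool) :=
  [seq it <- rev (ordered I) | it \in mask sel (edge_items I)].

Lemma chosen_perm sel : perm_eq (chosen sel) (mask sel (edge_items I)).
Proof.
have [uo mo _] := orderedP.
apply: uniq_perm => [||it]; rewrite ?filter_uniq ?rev_uniq ?mask_uniq ?edge_items_uniq //.
rewrite mem_filter mem_rev mo; case: (boolP (it \in mask _ _)) => //= h.
exact: mem_mask h.
Qed.

Lemma chosen_colors sel : feasible p I sel ->
  forall k, k < p -> colors (chosen sel) k = nth 0 (i_m I) k.
Proof. by case=> _ h k /h <-; apply: colors_lab; apply: chosen_perm. Qed.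

(** With no edge left, the key consists of colour counts only. All matching selections have the
    prescribed counts, so [final] contains at most one, and it dominates every feasible
    selection. *)
Lemma solutionP : solves p I (enc_answer (solution p I)).
Proof.
have dom sel : feasible p I sel -> exists2 t, t \in matching p I &
    obj_le (priced I) (chosen sel) t.
  move=> hf; have hsub : subseq (chosen sel) (rev (ordered I)) by apply: filter_subseq.
  have /dominatedP[t [tF /same_keyP[_ hc] hle]] := final_dominates hsub; exists t => //.
  apply/matchingP; split=> // k kp; rewrite -(chosen_colors hf kp).
  (* [same_key] compares only colours that occur on edges; for any other colour both counts are
     0. *)
  have [hk|hk] := boolP (k \in i_lab I).
    by move: hk; rewrite -unzip2_items => /mapP[it hit ->]; rewrite [RHS]hc.
  have z u : subseq u (rev (ordered I)) -> colors u k = 0.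
    move=> hu; apply/eqP; rewrite -leqn0 leqNgt -has_count.
    apply/negP => /hasP[it /(mem_subseq hu)].
    rewrite mem_rev => hit /eqP e; move/negP: hk; apply.
    have [_ mo _] := orderedP.
    by rewrite -e -unzip2_items map_f // -mo.
  by rewrite !z // final_subseq.
rewrite /solution; case: ifPn => hnil; [right|left].
  split=> // -[sel /dom[t]]; move: hnil; rewrite /nilp size_eq0 => /eqP -> //.
set s := head [::] (matching p I).
have sM : s \in matching p I.
  by move: hnil; rewrite /s; case: (matching p I) => // a l _; rewrite mem_head.
have [sF sc] := matchingP s sM.
have hperm := selection_perm (final_subseq sF).
exists (selection (edge_items I) s); split=> //.
  split; first by rewrite size_map size_zip size_lab minnn.
  by move=> k kp; rewrite -(colors_lab _ hperm) sc.
move=> sel hf; have [t tM hle] := dom _ hf; have [tF tc] := matchingP t tM.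
have ets : t = s.
  apply/eqP; apply: contraT => ne; have := final_incomparable.
  move/(pairwiseP [::]) => hpw.
  have st : same_key (edge_items I) [::] s t.
    apply/same_keyP; split=> // it /edge_items_bound[_ _ _ hp].
    by rewrite sc // tc.
  have ts : same_key (edge_items I) [::] t s by rewrite same_key_sym.
  move: (sF) (tF) => /(nthP [::])[i hi ei] /(nthP [::])[j hj ej].
  case: (ltngtP i j) => hij.
  - by have := hpw _ _ hi hj hij; rewrite ei ej st.
  - by have := hpw _ _ hj hi hij; rewrite ei ej ts.
  - by move: ne; rewrite -ei -ej hij eqxx.
rewrite ets in hle; rewrite (objectiveE hperm) (objectiveE (chosen_perm sel)).
by move: hle; rewrite /obj_le; lia.
Qed.

End Correctness.

Lemma csz_subseq (A : eqType) {cA : coded A} (s t : seq A) : subseq s t -> csz s <= csz t.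
Proof.
elim: t s => [|b t IH] [|a s] //=.
by case: eqP => [->|_] /IH; rewrite !csz_cons; lia.
Qed.

Lemma csz_rev A {cA : coded A} (s : seq A) : csz (rev s) = csz s.
Proof.
have h (t : seq A) : csz (catrev s t) + 1 = csz s + csz t.
  elim: s t => [|a s IH] t; first by rewrite addnC.
  by rewrite [catrev _ _]/= IH !csz_cons; lia.
by apply/eqP; rewrite -(eqn_add2r 1); apply/eqP; apply: h.
Qed.

Lemma csz_states its fV p K ord i :
  (forall it, it \in its -> it.2 < p) -> uniq ord -> ord =i its -> narrow its K ord ->
  i <= size ord ->
  csz (states its fV ord i) <= (csz ord + (csz ord).+1 ^ (K + p) * (csz ord).+1 + 1).+1.
Proof.
move=> h1 h2 h3 h4 hi; have [] := statesP its fV hi.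
have := size_states fV h1 h2 h3 h4 hi.
case: (states its fV ord i) => R S /= hs -> hsub _ _.
have hS : csz S <= size S * (csz ord).+1 + 1.
  apply: csz_all; apply/allP => s /hsub /csz_subseq hle; apply: leq_trans hle _.
  by rewrite csz_rev; apply: csz_subseq; apply: take_subseq.
have hR : csz (drop i ord) <= csz ord by apply: csz_subseq; apply: drop_subseq.
have hp : size S <= (csz ord).+1 ^ (K + p).
  apply: leq_trans hs _; case: (K + p) => // k.
  by rewrite leq_exp2r // ltnS size_le_csz.
have hm : size S * (csz ord).+1 <= (csz ord).+1 ^ (K + p) * (csz ord).+1.
  by rewrite leq_mul2r hp orbT.
rewrite csz_pair ltnS -addnA; apply: leq_add hR (leq_trans hS _).
by rewrite leq_add2r.
Qed.

(** * Polynomial time on valid instances *)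

Section Complexity.
Variables p d : nat.

Definition valid_input := {I : instance | valid_instance p d I}.

#[local] Instance coded_input : coded valid_input := fun x => code (rev (enc_instance (sval x))).

(** Parsing yields literally [code (raw I)], so the parsing program itself computes [raw] without
    any conversion. *)
Lemma pt_raw : ptime (fun x : valid_input => raw (sval x)).
Proof.
have [c [k h]] := pt_parse; exists c, k => x.
by have := h (rev (enc_instance (sval x))); rewrite parse_instance.
Qed.

Lemma pt_values : ptime (fun x : valid_input => values (sval x)).
Proof.
have h := pt_raw; have : ptime (fun x : valid_input => (raw (sval x)).2.2.2.2.1) by pt.
by [].
Qed.

Lemma pt_edge_items : ptime (fun x : valid_input => edge_items (sval x)).
Proof.
have h := pt_raw.
apply: (@ptime_ext _ _ _ _ (fun x : valid_input =>
  zip [seq (e.1, e.2.1) | e <- (raw (sval x)).2.1] (raw (sval x)).2.2.1)).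
  move=> x; rewrite /edge_items /= -map_comp; congr zip.
  by rewrite -[RHS]map_id; apply: eq_map => -[].
by apply: (pt_zip 0); pt.
Qed.

Lemma pt_vertices : ptime (fun x : valid_input => vertices (sval x)).
Proof. exact: pt_iota pt_values. Qed.

Lemma pt_priced : ptime (fun x : valid_input => priced (sval x)).
Proof. exact: (pt_zip [::] pt_vertices pt_values). Qed.

Lemma pt_ordered : ptime (fun x : valid_input => ordered (sval x)).
Proof. exact: pt_snd (pt_search pt_edge_items pt_vertices). Qed.

(** A round may double the list before pruning, so no additive growth bound is at hand and
    [csz_states] bounds each accumulator outright. The exponent [2 ^ d + p] is constant because [p]
    and [d] are fixed. *)
Lemma pt_final : ptime (fun x : valid_input => final (sval x)).
Proof.
have h1 := pt_ordered; have h2 := pt_edge_items; have h3 := pt_priced.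
have [q hq hs] := ptime_size h1.
apply: (@ptime_ext _ _ _ _ (fun x : valid_input => (foldl (extend (edge_items (sval x))
  (priced (sval x))) (ordered (sval x), [:: [::]]) (ordered (sval x))).2)).
  by move=> x; rewrite /final /states take_size.
apply: pt_snd.
apply: (@ptime_foldl _ _ _ _ _ _
  (fun x : valid_input => extend (edge_items (sval x)) (priced (sval x)))
  (fun x => (ordered (sval x), [:: [::]])) _
  (fun n => (q n + (q n).+2 ^ (2 ^ d + p) * (q n).+1 + 1).+1)) => //.
- by apply: pt_extend; pt.
- by pt.
- by solve_poly.
move=> x i; have v := svalP x; have [u1 u2 u3] := orderedP v.
set o := ordered (sval x) in u1 u2 u3 *.
have -> : take i o = take (minn i (size o)) o.
  by rewrite /minn; case: ltnP => // hi; rewrite take_size take_oversize.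
have := @csz_states _ (priced (sval x)) p _ _ (minn i (size o)) _ u1 u2 u3 (geq_minr _ _).
move=> h; apply: leq_trans (h _) _.
  by move=> it /(edge_items_bound v)[].
have ho : csz o <= q (csz x) by apply: hs.
rewrite ltnS leq_add2r; apply: leq_add => //; apply: leq_mul; last by rewrite ltnS.
by case: (2 ^ d + p) => // k; rewrite leq_exp2r // ltnS; apply: leq_trans ho _.
Qed.

Lemma pt_matching : ptime (fun x : valid_input => matching p (sval x)).
Proof.
have h1 := pt_final; have h2 := pt_raw.
have h3 : ptime (fun x : valid_input => zip (iota 0 p) (i_m (sval x))).
  have : ptime (fun x : valid_input => zip (iota 0 p) (raw (sval x)).2.2.2.1).
    by apply: (pt_zip 0); pt.
  by [].
rewrite /matching; apply: pt_filter => //.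
apply: pt_all; last by pt.
by apply: pt_eqn; last pt; apply: pt_colors; pt.
Qed.

Lemma pt_enc_some X (cX : coded X) (s : X -> seq bool) :
  ptime s -> ptime (fun x => enc_answer (Some (s x))).
Proof.
move=> hs; apply: (@ptime_ext _ _ _ _ (fun x => [:: true; false] ++ enc (DNat 1) ++
  [:: true; false] ++ flatten [seq if b then enc (DNat 1) else enc (DNat 0) | b <- s x]
  ++ [:: true; true; true; true])).
  move=> x.
  have encL l : enc (DList l) = [:: true; false] ++ flatten (map enc l) ++ [:: true; true] by [].
  have -> : [seq if b then enc (DNat 1) else enc (DNat 0) | b <- s x]
      = map enc [seq DNat (nat_of_bool b) | b <- s x].
    by rewrite -map_comp; apply: eq_map => -[].
  have flat2 a b : flatten (map enc [:: a; b]) = enc a ++ enc b by rewrite /= cats0.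
  by rewrite /enc_answer encL flat2 (encL (map _ _)) -!catA.
by pt.
Qed.

Lemma pt_solution : ptime (fun x : valid_input => enc_answer (solution p (sval x))).
Proof.
have h1 := pt_matching; have h2 := pt_edge_items.
apply: (@ptime_ext _ _ _ _ (fun x : valid_input =>
  if nilp (matching p (sval x)) then enc_answer None
  else enc_answer (Some (selection (edge_items (sval x)) (head [::] (matching p (sval x))))))).
  by move=> x; rewrite /solution; case: ifP.
apply: pt_if; [by pt|by pt|apply: pt_enc_some].
by rewrite /selection; pt.
Qed.

End Complexity.

Theorem theorem1p2 (p d : nat) (hp : 0 < p) (hd : 0 < d) :
  exists (M : TM) (c k : nat),
    forall I : instance, valid_instance p d I ->
      exists (t : nat) (cf : config M),
        [/\ t <= c * (size (enc_instance I)).+1 ^ k,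
            exec t (init M (enc_instance I)) = Some cf
          & solves p I (output cf)].
Proof.
have [M [k h]] := ptime_machine (pt_solution p d).
(* [n.+2] is at most [2 * n.+1], whence the factor [2 ^ k]. *)
exists M, (2 ^ k), k => I v; have [t [cf [h1 h2 h3]]] := h (exist _ I v).
exists t, cf; split=> //; last by rewrite h3; apply: solutionP v.
apply: leq_trans h1 _; rewrite -expnMn; case: (k) => // k'.
by rewrite leq_exp2r //=; lia.
Qed.
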